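(* A module $M$ over a poset $Q$ (with coefficients in a field $k$) is finitely encoded if and only if it admits one, and hence all, of the following: (1) a finite fringe presentation; or (2) a finite upset presentation; or (3) a finite downset copresentation; or (4) a finite upset resolution; or (5) a finite downset resolution; or (6) any of the objects in items (1)–(5) subordinate to any given finite encoding of $M$; or (7) a finite encoding dominating any given one of items (1)–(5). The equivalences remain true over any partially ordered real vector space of finite dimension if ''finitely encoded'' and all occurrences of ''finite'' are replaced by ''semialgebraic''.
   Context: A module $M$ over a poset $Q$ is a $Q$-graded $k$-vector space $M=\bigoplus_{q\in Q}M_q$ with linear structure maps $M_q\to M_{q'}$ for $q\preceq q'$, compatible with composition. Homomorphisms are degree-preserving linear maps commuting with structure maps. $k[Q]$ is the $Q$-module with $k$ in every degree and identity structure maps. For an upset $U\subseteq Q$ (closed under going up), the upset module $k[U]\subseteq k[Q]$ is the submodule that is $k$ in degrees from $U$ and $0$ elsewhere; for a downset $D\subseteq Q$ (closed under going down) the downset module $k[D]$ is the quotient of $k[Q]$ that is $k$ in degrees from $D$ and $0$ elsewhere. A homomorphism $k[U]\to k[D]$ is connected if there is a scalar $\lambda\in k$ such that it acts as multiplication by $\lambda$ in every degree $q\in U\cap D$. An encoding of $M$ by a poset $P$ is a poset morphism $\pi:Q\to P$ together with a $P$-module $H$ such that $M\cong\pi^*H=\bigoplus_{q\in Q}H_{\pi(q)}$. It is finite if $P$ is finite and every $H_p$ has finite dimension. $M$ is finitely encoded if it has a finite encoding. If $Q$ is a partially ordered real vector space of finite dimension (a finite-dimensional real vector space whose additive group is generated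 by a submonoid $Q_+$ with trivial unit group, ordered by $q\preceq q'\iff q'-q\in Q_+$), a finite encoding is semialgebraic if the fibers of $\pi$ are real semialgebraic sets, and $M$ is semialgebraic if it has a semialgebraic encoding. A fringe presentation of $M$ is a homomorphism $F\to E$ from a direct sum $F$ of upset modules to a direct sum $E$ of downset modules, with image isomorphic to $M$ and all components $k[U]\to k[D]$ connected. An upset presentation of $M$ is an expression of $M$ as the cokernel of a homomorphism $F_1\to F_0$ of direct sums of upset modules. A downset copresentation of $M$ is an expression of $M$ as the kernel of a homomorphism $E^0\to E^1$ of direct sums of downset modules. An upset resolution of $M$ is a complex $F_\bullet$ ($F_i\to F_{i-1}$, homological degrees $\geq 0$) of direct sums of upset modules whose only nonzero homology is $H_0(F_\bullet)\cong M$. A downset resolution of $M$ is a complex $E^\bullet$ ($E^i\to E^{i+1}$, cohomological degrees $\geq 0$) of direct sums of downset modules whose only nonzero cohomology is $H^0(E^\bullet)\cong M$. Any of these objects is finite if its total number of indicator (upset or downset) summands is finite; it is subordinate to an encoding of $M$ if each indicator summand is constant on every fiber of the encoding poset morphism (equivalently, its upset or downset is a union of fibers), in which case the encoding is said to dominate it; and it is semialgebraic if $Q$ is a partially ordered real vector space of finite dimension and it is subordinate to a semialgebraic encoding of $M$.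
   Formalization: The maps in upset presentations, downset copresentations and upset/downset resolutions are also required to have connected components (one scalar per component k[U]→k[U'], k[D]→k[D']); without this a finite upset presentation need not give a finite encoding over an infinite field. *)

(* Defs.v *)
From HB Require Import structures.
From mathcomp Require Import all_boot all_order all_algebra.
From mathcomp Require Import boolp classical_sets cardinality reals.
From mathcomp Require mpoly.

Set Implicit Arguments.
Unset Strict Implicit.
Unset Printing Implicit Defensive.

Import Order.TTheory GRing.Theory Num.Theory.
Local Open Scope ring_scope.
Local Open Scope quotient_scope.

Definition finite_dimensional (k : fieldType) (V : lmodType k) : Prop :=
  exists n, inhabited (Vector.axiom n V).

Section Subspace.
Variables (k : fieldType) (V : lmodType k) (S : submodClosed V).

Inductive subspace : Type := Subspace (x : V) of x \in S.
Definition subspace_val (u : subspace) : V := let: Subspace x _ := u in x.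
HB.instance Definition _ := [isSub for subspace_val].
HB.instance Definition _ := [Choice of subspace by <:].
HB.instance Definition _ := [SubChoice_isSubLmodule of subspace by <:].
End Subspace.

(* The quotient V / S: the library provides the zmodType Quotient.quot S; only the
   scalar action is missing. *)
Section QuotientSpace.
Variables (k : fieldType) (V : lmodType k) (S : submodClosed V).

Definition submod_pred : {pred V} := S.
Lemma submod_pred_closed : zmod_closed submod_pred.
Proof.
split; first exact: (rpred0 S).
by move=> x y Sx Sy; rewrite -scaleN1r; apply: (rpredD Sx); apply: (rpredZ (-1)).
Qed.
HB.instance Definition _ := GRing.isZmodClosed.Build V submod_pred submod_pred_closed.

Definition qspace : Type := Quotient.quot submod_pred.
HB.instance Definition _ := GRing.Zmodule.on qspace.

Definition qclass (x : V) : qspace := \pi_(Quotient.quot submod_pred) x.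
Definition qrepr (x : qspace) : V := repr (x : Quotient.quot submod_pred).

Lemma qreprK x : qclass (qrepr x) = x.
Proof. exact: reprK. Qed.

Lemma qclassP x y : (qclass x == qclass y) = (x - y \in S).
Proof. exact/esym/(Quotient.idealrBE submod_pred). Qed.

Lemma qclassB : zmod_morphism qclass.
Proof. exact: pi_is_zmod_morphism. Qed.
HB.instance Definition _ := GRing.isZmodMorphism.Build V qspace qclass qclassB.

Definition qscale (a : k) (x : qspace) : qspace := qclass (a *: qrepr x).

Lemma qscaleE a x : qscale a (qclass x) = qclass (a *: x).
Proof.
apply/eqP; rewrite qclassP -scalerBr rpredZ // -qclassP.
by rewrite qreprK.
Qed.

Lemma qscaleA a b x : qscale a (qscale b x) = qscale (a * b) x.
Proof. by rewrite -[x]qreprK !qscaleE scalerA. Qed.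
Lemma qscale1 : left_id 1 qscale.
Proof. by move=> x; rewrite -[x]qreprK qscaleE scale1r. Qed.
Lemma qscaleDr : right_distributive qscale +%R.
Proof.
move=> a x y; rewrite -[x]qreprK -[y]qreprK.
by rewrite -(raddfD qclass) !qscaleE -(raddfD qclass) -scalerDr.
Qed.
Lemma qscaleDl x : {morph qscale^~ x : a b / a + b}.
Proof. by move=> a b; rewrite -[x]qreprK !qscaleE -raddfD -scalerDl. Qed.

HB.instance Definition _ := GRing.Zmodule_isLmodule.Build k qspace
  qscaleA qscale1 qscaleDr qscaleDl.

Lemma qclass_linear : linear qclass.
Proof. by move=> a x y; rewrite (raddfD qclass); congr (_ + _); apply/esym/qscaleE. Qed.
End QuotientSpace.

HB.instance Definition _ (k : fieldType) (V : lmodType k) (S : submodClosed V) :=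
  GRing.isLinear.Build k V (qspace S) _ (@qclass k V S) (@qclass_linear k V S).

Section ProductSpace.
Variables (k : fieldType) (I : Type) (V : I -> lmodType k).

Definition prodspace : Type := forall i, V i.
HB.instance Definition _ := Choice.on prodspace.

Let add (x y : prodspace) : prodspace := fun i => x i + y i.
Let zero : prodspace := fun=> 0.
Let opp (x : prodspace) : prodspace := fun i => - x i.
Let scale (a : k) (x : prodspace) : prodspace := fun i => a *: x i.
Let addA : associative add.
Proof. by move=> x y z; apply: functional_extensionality_dep => i; apply: addrA. Qed.
Let addC : commutative add.
Proof. by move=> x y; apply: functional_extensionality_dep => i; apply: addrC. Qed.
Let add0 : left_id zero add.
Proof. by move=> x; apply: functional_extensionality_dep => i; apply: add0r. Qed.
Let addN : left_inverse zero opp add.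
Proof. by move=> x; apply: functional_extensionality_dep => i; apply: addNr. Qed.
HB.instance Definition _ := GRing.isZmodule.Build prodspace addA addC add0 addN.

Let scaleA a b x : scale a (scale b x) = scale (a * b) x.
Proof. by apply: functional_extensionality_dep => i; apply: scalerA. Qed.
Let scale1 : left_id 1 scale.
Proof. by move=> x; apply: functional_extensionality_dep => i; apply: scale1r. Qed.
Let scaleDr : right_distributive scale +%R.
Proof. by move=> a x y; apply: functional_extensionality_dep => i; apply: scalerDr. Qed.
Let scaleDl x : {morph scale^~ x : a b / a + b}.
Proof. by move=> a b; apply: functional_extensionality_dep => i; apply: scalerDl. Qed.
HB.instance Definition _ := GRing.Zmodule_isLmodule.Build k prodspace
  scaleA scale1 scaleDr scaleDl.
End ProductSpace.

Record pmodule (k : fieldType) (d : Order.disp_t) (Q : porderType d) := PModule {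
  pcar :> Q -> lmodType k;
  pmap : forall q q' : Q, (q <= q')%O -> pcar q -> pcar q';
  pmap_linear : forall q q' (h : (q <= q')%O), linear (pmap h);
  pmap_id : forall q (h : (q <= q)%O) x, pmap h x = x;
  pmap_comp : forall q q' q'' (h : (q <= q')%O) (h' : (q' <= q'')%O)
    (h'' : (q <= q'')%O) x, pmap h'' x = pmap h' (pmap h x) }.

Arguments pmap {k d Q} M {q q'} h x : rename.
Arguments pmap_linear {k d Q} M {q q'} h : rename.
Arguments pmap_id {k d Q} M {q} h x : rename.
Arguments pmap_comp {k d Q} M {q q' q''} h h' h'' x : rename.

HB.instance Definition _ (k : fieldType) d (Q : porderType d) (M : pmodule k Q)
    (q q' : Q) (h : (q <= q')%O) :=
  GRing.isLinear.Build k (M q) (M q') _ (pmap M h) (pmap_linear M h).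

Record phom (k : fieldType) d (Q : porderType d) (M N : pmodule k Q) := PHom {
  hfun :> forall q, M q -> N q;
  hfun_linear : forall q, linear (@hfun q);
  hfun_nat : forall q q' (h : (q <= q')%O) x,
    hfun (pmap M h x) = pmap N h (hfun x) }.

Arguments hfun {k d Q M N} f q x : rename.
Arguments hfun_linear {k d Q M N} f q : rename.
Arguments hfun_nat {k d Q M N} f {q q'} h x : rename.

HB.instance Definition _ (k : fieldType) d (Q : porderType d) (M N : pmodule k Q)
    (f : phom M N) (q : Q) :=
  GRing.isLinear.Build k (M q) (N q) _ (hfun f q) (hfun_linear f q).

Local Obligation Tactic := idtac.

Section Modules.
Variables (k : fieldType) (d : Order.disp_t) (Q : porderType d).
Implicit Types M N L : pmodule k Q.

Definition piso M N : Prop :=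
  exists f : phom M N, forall q, bijective (f q).

Definition pis_zero M : Prop := forall q (x : M q), x = 0.

Program Definition phom_comp L M N (g : phom M N) (f : phom L M) : phom L N :=
  @PHom k d Q L N (fun q x => g q (f q x)) _ _.
Next Obligation. by move=> L M N g f q a x y; rewrite !linearP. Qed.
Next Obligation. by move=> L M N g f q q' h x /=; rewrite !hfun_nat. Qed.

Program Definition phom_zero M N : phom M N := @PHom k d Q M N (fun q x => 0) _ _.
Next Obligation. by move=> M N q a x y; rewrite scaler0 addr0. Qed.
Next Obligation. by move=> M N q q' h x /=; rewrite linear0. Qed.

Record psub M := PSub {
  psub_space :> forall q, submodClosed (M q);
  psub_stable : forall q q' (h : (q <= q')%O) (x : M q),
    x \in psub_space q -> pmap M h x \in psub_space q' }.

Program Definition psub_mod M (S : psub M) : pmodule k Q :=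
  @PModule k d Q (fun q => subspace (S q) : lmodType k)
    (fun q q' h x => Subspace (psub_stable h (valP x))) _ _ _.
Next Obligation. by move=> M S q q' h a x y; apply/val_inj; rewrite /= !linearP. Qed.
Next Obligation. by move=> M S q h x; apply/val_inj; rewrite /= pmap_id. Qed.
Next Obligation.
by move=> M S q q' q'' h h' h'' x; apply/val_inj; rewrite /= (pmap_comp _ h h').
Qed.

Program Definition psub_incl M (S : psub M) : phom (psub_mod S) M :=
  @PHom k d Q (psub_mod S) M (fun q x => val x) _ _.
Next Obligation. by []. Qed.
Next Obligation. by []. Qed.

Definition pquot_map M (S : psub M) q q' (h : (q <= q')%O) (x : qspace (S q)) :
  qspace (S q') := qclass (S q') (pmap M h (qrepr x)).

Lemma pquot_mapE M (S : psub M) q q' (h : (q <= q')%O) (x : M q) :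
  pquot_map h (qclass (S q) x) = qclass (S q') (pmap M h x).
Proof.
apply/eqP; rewrite qclassP -linearB psub_stable // -qclassP.
by rewrite qreprK.
Qed.

Program Definition pquot_mod M (S : psub M) : pmodule k Q :=
  @PModule k d Q (fun q => qspace (S q) : lmodType k) (@pquot_map M S) _ _ _.
Next Obligation.
move=> M S q q' h a x y; rewrite -[x]qreprK -[y]qreprK.
by rewrite -linearP !pquot_mapE -!linearP.
Qed.
Next Obligation. by move=> M S q h x; rewrite -[x]qreprK pquot_mapE pmap_id. Qed.
Next Obligation.
move=> M S q q' q'' h h' h'' x.
by rewrite -[x]qreprK !pquot_mapE (pmap_comp _ h h').
Qed.

Program Definition pquot_proj M (S : psub M) : phom M (pquot_mod S) :=
  @PHom k d Q M (pquot_mod S) (fun q => qclass (S q)) _ _.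
Next Obligation. by move=> M S q a x y; rewrite linearP. Qed.
Next Obligation. by move=> M S q q' h x; rewrite /= pquot_mapE. Qed.

Section Kernel.
Variables (M N : pmodule k Q) (f : phom M N) (T : psub N).

Definition ppre_pred q : {pred M q} := fun x => f q x \in T q.
Arguments ppre_pred q _ : clear implicits.
Lemma ppre_predE q x : (x \in ppre_pred q) = (f q x \in T q). Proof. by []. Qed.
Lemma ppre_closed q : submod_closed (ppre_pred q).
Proof.
split=> [|a x y]; rewrite !ppre_predE; first by rewrite linear0 rpred0.
by move=> Tx Ty; rewrite linearP rpredD ?rpredZ.
Qed.
HB.instance Definition _ q :=
  GRing.isSubmodClosed.Build k (M q) (ppre_pred q) (ppre_closed q).
Lemma ppre_stable q q' (h : (q <= q')%O) x :
  x \in ppre_pred q -> pmap M h x \in ppre_pred q'.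
Proof. by rewrite !ppre_predE hfun_nat; apply: psub_stable. Qed.
Definition ppreim : psub M := PSub ppre_stable.

Definition pker_pred q : {pred M q} := fun x => f q x == 0.
Arguments pker_pred q _ : clear implicits.
Lemma pker_predE q x : (x \in pker_pred q) = (f q x == 0). Proof. by []. Qed.
Lemma pker_closed q : submod_closed (pker_pred q).
Proof.
split=> [|a x y]; rewrite !pker_predE ?linear0 //.
by move=> /eqP fx /eqP fy; rewrite linearP /= fx fy scaler0 addr0.
Qed.
HB.instance Definition _ q :=
  GRing.isSubmodClosed.Build k (M q) (pker_pred q) (pker_closed q).
Lemma pker_stable q q' (h : (q <= q')%O) x :
  x \in pker_pred q -> pmap M h x \in pker_pred q'.
Proof. by rewrite !pker_predE hfun_nat => /eqP ->; rewrite linear0. Qed.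
Definition pker : psub M := PSub pker_stable.

Definition pim_pred q : {pred N q} := fun y => `[< exists x, f q x = y >].
Arguments pim_pred q _ : clear implicits.
Lemma pim_predP q y : reflect (exists x, f q x = y) (y \in pim_pred q).
Proof. exact: asboolP. Qed.
Lemma pim_closed q : submod_closed (pim_pred q).
Proof.
split=> [|a y y']; first by apply/pim_predP; exists 0; rewrite linear0.
move=> /pim_predP[x <-] /pim_predP[x' <-].
by apply/pim_predP; exists (a *: x + x'); rewrite linearP.
Qed.
HB.instance Definition _ q :=
  GRing.isSubmodClosed.Build k (N q) (pim_pred q) (pim_closed q).
Lemma pim_stable q q' (h : (q <= q')%O) y :
  y \in pim_pred q -> pmap N h y \in pim_pred q'.
Proof.
move=> /pim_predP[x <-].
by apply/pim_predP; exists (pmap M h x); rewrite hfun_nat.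
Qed.
Definition pim : psub N := PSub pim_stable.
End Kernel.

Definition pkernel M N (f : phom M N) : pmodule k Q := psub_mod (pker f).
Definition pimage M N (f : phom M N) : pmodule k Q := psub_mod (pim f).
Definition pcokernel M N (f : phom M N) : pmodule k Q := pquot_mod (pim f).

(* ker g / im f for L -f-> M -g-> N *)
Definition phomology L M N (f : phom L M) (g : phom M N) : pmodule k Q :=
  pquot_mod (ppreim (psub_incl (pker g)) (pim f)).

Section DirectSum.
Variables (I : choiceType) (M : I -> pmodule k Q).

Program Definition pprod : pmodule k Q :=
  @PModule k d Q (fun q => prodspace (fun i => M i q) : lmodType k)
    (fun q q' h x i => pmap (M i) h (x i)) _ _ _.
Next Obligation.
by move=> q q' h a x y; apply: functional_extensionality_dep => i; rewrite linearP.
Qed.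
Next Obligation.
by move=> q h x; apply: functional_extensionality_dep => i; rewrite pmap_id.
Qed.
Next Obligation.
move=> q q' q'' h h' h'' x; apply: functional_extensionality_dep => i.
by rewrite (pmap_comp _ h h').
Qed.

Definition fsupp_pred q : {pred pprod q} :=
  fun x => `[< finite_set [set i | x i != 0] >].
Arguments fsupp_pred q _ : clear implicits.
Lemma fsupp_predP q (x : pprod q) :
  reflect (finite_set [set i | x i != 0]) (x \in fsupp_pred q).
Proof. exact: asboolP. Qed.
Lemma fsupp_closed q : submod_closed (fsupp_pred q).
Proof.
split=> [|a x y].
  apply/fsupp_predP; rewrite (_ : [set _ | _]%classic = classical_sets.set0) //.
  by apply/seteqP; split=> i //=; rewrite eqxx.
move=> /fsupp_predP fx /fsupp_predP fy; apply/fsupp_predP.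
apply: (@sub_finite_set _ _ ([set i | x i != 0] `|` [set i | y i != 0])%classic).
  move=> i; change (a *: x i + y i != 0 -> x i != 0 \/ y i != 0).
  by case: (eqVneq (x i) 0) => [->|]; [rewrite scaler0 add0r; right|left].
by rewrite finite_setU.
Qed.
HB.instance Definition _ q :=
  GRing.isSubmodClosed.Build k (pprod q) (fsupp_pred q) (fsupp_closed q).
Lemma fsupp_stable q q' (h : (q <= q')%O) x :
  x \in fsupp_pred q -> pmap pprod h x \in fsupp_pred q'.
Proof.
move=> /fsupp_predP fx; apply/fsupp_predP.
apply: sub_finite_set fx => i /=; apply: contra_neq => xi0.
by rewrite xi0 linear0.
Qed.
Definition psum : pmodule k Q := psub_mod (PSub fsupp_stable).

Definition psum_proj_fun i q (x : psum q) : M i q := (val x : prodspace _) i.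
Program Definition psum_proj i : phom psum (M i) :=
  @PHom k d Q psum (M i) (@psum_proj_fun i) _ _.
Next Obligation. by []. Qed.
Next Obligation. by []. Qed.

Definition psum_inj_val i q (x : M i q) : pprod q :=
  @dfwith I (fun i => M i q) (fun=> 0) i x.
Lemma psum_inj_subproof i q (x : M i q) : psum_inj_val x \in fsupp_pred q.
Proof.
apply/fsupp_predP; apply: (@sub_finite_set _ _ [set i]%classic) => // j /= Hj.
apply/eqP; apply: contraNT Hj => ji.
by rewrite /psum_inj_val dfwith_out // eq_sym.
Qed.
Program Definition psum_inj i : phom (M i) psum :=
  @PHom k d Q (M i) psum (fun q x => Subspace (psum_inj_subproof x)) _ _.
Next Obligation.
move=> i q a x y; apply/val_inj; apply: functional_extensionality_dep => j /=.
rewrite -[RHS]/(a *: psum_inj_val x j + psum_inj_val y j) /psum_inj_val.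
have [<-|ij] := eqVneq i j; first by rewrite !dfwith_in.
by rewrite !dfwith_out // scaler0 addr0.
Qed.
Next Obligation.
move=> i q q' h x; apply/val_inj; apply: functional_extensionality_dep => j /=.
rewrite /psum_inj_val.
have [<-|ij] := eqVneq i j; first by rewrite !dfwith_in.
by rewrite !dfwith_out // linear0.
Qed.
End DirectSum.

Record upset := Upset {
  upset_set :> Q -> Prop;
  upsetP : forall q q' : Q, (q <= q')%O -> upset_set q -> upset_set q' }.

Record downset := Downset {
  downset_set :> Q -> Prop;
  downsetP : forall q q' : Q, (q <= q')%O -> downset_set q' -> downset_set q }.

Program Definition pconst : pmodule k Q :=
  @PModule k d Q (fun=> k^o : lmodType k) (fun q q' h x => x) _ _ _.
Next Obligation. by []. Qed.
Next Obligation. by []. Qed.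
Next Obligation. by []. Qed.

Definition upset_pred (U : upset) q : {pred pconst q} := fun x => `[< U q \/ x = 0 >].
Arguments upset_pred U q _ : clear implicits.
Lemma upset_predP (U : upset) q (x : pconst q) :
  reflect (U q \/ x = 0) (x \in upset_pred U q).
Proof. exact: asboolP. Qed.
Lemma upset_closed (U : upset) q : submod_closed (upset_pred U q).
Proof.
split=> [|a x y]; first by apply/upset_predP; right.
move=> /upset_predP hx /upset_predP hy; apply/upset_predP.
by case: hx hy => [Uq|->]; [left|case=> [Uq|->]; [left|right; rewrite scaler0 addr0]].
Qed.
HB.instance Definition _ (U : upset) q :=
  GRing.isSubmodClosed.Build k (pconst q) (upset_pred U q) (upset_closed U q).
Lemma upset_stable (U : upset) q q' (h : (q <= q')%O) (x : pconst q) :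
  x \in upset_pred U q -> pmap pconst h x \in upset_pred U q'.
Proof.
move=> /upset_predP hx; apply/upset_predP.
by case: hx => [/(upsetP h)|]; [left|right].
Qed.

Definition upset_sub (U : upset) : psub pconst := PSub (@upset_stable U).

Definition upset_mod (U : upset) : pmodule k Q := psub_mod (upset_sub U).

Program Definition downsetC (D : downset) : upset := @Upset (fun q => ~ D q) _.
Next Obligation. by move=> D q q' h Dq /(downsetP h). Qed.

Definition downset_mod (D : downset) : pmodule k Q := pquot_mod (upset_sub (downsetC D)).

(* Connectedness is required below of the components of all maps, in fringe
   presentations as well as in (co)presentations and resolutions.  It cannot be
   dropped for the latter: let Q be the antichain k (k infinite) with a bottom
   element b added.  The map k[Q \ b] -> k[Q] (+) k[Q] sending 1 to (1, c) in
   degree c is a finite upset presentation with non-connected components; its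
   cokernel M has pairwise distinct kernels M_b -> M_c, so M has no finite
   encoding.

   A homomorphism between indicator modules acts on representatives in k[Q] as
   multiplication by one scalar in all the degrees common to both sets. *)
Definition connected_UD (U : upset) (D : downset)
    (f : phom (upset_mod U) (downset_mod D)) : Prop :=
  exists lam : k, forall q, U q -> D q ->
    forall x : upset_mod U q, f q x = pquot_proj _ q (lam *: val x : pconst q).

Definition connected_UU (U U' : upset) (f : phom (upset_mod U) (upset_mod U')) : Prop :=
  exists lam : k, forall q, U q -> U' q ->
    forall x : upset_mod U q, val (f q x) = lam *: val x :> pconst q.

Definition connected_DD (D D' : downset)
    (f : phom (downset_mod D) (downset_mod D')) : Prop :=
  exists lam : k, forall q, D q -> D' q -> forall x : pconst q,
    f q (pquot_proj (upset_sub (downsetC D)) q x) =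
      pquot_proj (upset_sub (downsetC D')) q (lam *: x : pconst q).

Definition upset_sum (I : choiceType) (U : I -> upset) : pmodule k Q :=
  psum (fun i => upset_mod (U i)).
Definition downset_sum (I : choiceType) (D : I -> downset) : pmodule k Q :=
  psum (fun i => downset_mod (D i)).

Definition pcomponent (I J : choiceType) (M : I -> pmodule k Q) (N : J -> pmodule k Q)
    (f : phom (psum M) (psum N)) i j : phom (M i) (N j) :=
  phom_comp (psum_proj N j) (phom_comp f (psum_inj M i)).

Record fringe_presentation M := FringePresentation {
  fr_I : choiceType;
  fr_U : fr_I -> upset;
  fr_J : choiceType;
  fr_D : fr_J -> downset;
  fr_map : phom (upset_sum fr_U) (downset_sum fr_D);
  fr_connected : forall i j, connected_UD (pcomponent fr_map i j);
  fr_image : piso (pimage fr_map) M }.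

Record upset_presentation M := UpsetPresentation {
  up_I1 : choiceType;
  up_U1 : up_I1 -> upset;
  up_I0 : choiceType;
  up_U0 : up_I0 -> upset;
  up_map : phom (upset_sum up_U1) (upset_sum up_U0);
  up_connected : forall i j, connected_UU (pcomponent up_map i j);
  up_coker : piso (pcokernel up_map) M }.

Record downset_copresentation M := DownsetCopresentation {
  dc_I0 : choiceType;
  dc_D0 : dc_I0 -> downset;
  dc_I1 : choiceType;
  dc_D1 : dc_I1 -> downset;
  dc_map : phom (downset_sum dc_D0) (downset_sum dc_D1);
  dc_connected : forall i j, connected_DD (pcomponent dc_map i j);
  dc_ker : piso (pkernel dc_map) M }.

(* The zero endomorphism stands for the zero map F_0 -> 0 (resp. 0 -> E^0 in
   cohomology): it has the same kernel (resp. image). *)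
Definition chain_homology (F : nat -> pmodule k Q)
    (dF : forall n, phom (F n.+1) (F n)) (n : nat) : pmodule k Q :=
  match n with
  | 0 => phomology (dF 0) (phom_zero (F 0) (F 0))
  | m.+1 => phomology (dF m.+1) (dF m)
  end.

Definition cochain_cohomology (E : nat -> pmodule k Q)
    (dE : forall n, phom (E n) (E n.+1)) (n : nat) : pmodule k Q :=
  match n with
  | 0 => phomology (phom_zero (E 0) (E 0)) (dE 0)
  | m.+1 => phomology (dE m) (dE m.+1)
  end.

Record upset_resolution M := UpsetResolution {
  ur_I : nat -> choiceType;
  ur_U : forall n, ur_I n -> upset;
  ur_d : forall n, phom (upset_sum (@ur_U n.+1)) (upset_sum (@ur_U n));
  ur_connected : forall n i j, connected_UU (pcomponent (ur_d n) i j);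
  ur_complex : forall n q x, ur_d n q (ur_d n.+1 q x) = 0;
  ur_H0 : piso (chain_homology ur_d 0) M;
  ur_acyclic : forall n, (0 < n)%N -> pis_zero (chain_homology ur_d n) }.

Record downset_resolution M := DownsetResolution {
  dr_I : nat -> choiceType;
  dr_D : forall n, dr_I n -> downset;
  dr_d : forall n, phom (downset_sum (@dr_D n)) (downset_sum (@dr_D n.+1));
  dr_connected : forall n i j, connected_DD (pcomponent (dr_d n) i j);
  dr_complex : forall n q x, dr_d n.+1 q (dr_d n q x) = 0;
  dr_H0 : piso (cochain_cohomology dr_d 0) M;
  dr_acyclic : forall n, (0 < n)%N -> pis_zero (cochain_cohomology dr_d n) }.

Variant object_kind :=
  | FringePres | UpsetPres | DownsetCopres | UpsetRes | DownsetRes.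

Definition object (t : object_kind) M : Type :=
  match t with
  | FringePres => fringe_presentation M
  | UpsetPres => upset_presentation M
  | DownsetCopres => downset_copresentation M
  | UpsetRes => upset_resolution M
  | DownsetRes => downset_resolution M
  end.

(* The index type of all the indicator summands of an object, and the upset or
   downset carried by each of them. *)
Definition summand (t : object_kind) M : object t M -> Type :=
  match t return object t M -> Type with
  | FringePres => fun X => (fr_I X + fr_J X)%type
  | UpsetPres => fun X => (up_I1 X + up_I0 X)%type
  | DownsetCopres => fun X => (dc_I0 X + dc_I1 X)%type
  | UpsetRes => fun X => {n : nat & ur_I X n}
  | DownsetRes => fun X => {n : nat & dr_I X n}
  end.

Definition summand_set (t : object_kind) M : forall X : object t M, summand X -> set Q :=
  match t return forall X : object t M, summand X -> set Q with
  | FringePres => fun X s =>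
      match s with inl i => upset_set (fr_U i) | inr j => downset_set (fr_D j) end
  | UpsetPres => fun X s =>
      match s with inl i => upset_set (up_U1 i) | inr j => upset_set (up_U0 j) end
  | DownsetCopres => fun X s =>
      match s with inl i => downset_set (dc_D0 i) | inr j => downset_set (dc_D1 j) end
  | UpsetRes => fun X s => upset_set (ur_U (tagged s))
  | DownsetRes => fun X s => downset_set (dr_D (tagged s))
  end.

Definition finite_object (t : object_kind) M (X : object t M) : Prop :=
  finite_set [set: summand X].

End Modules.

Arguments upset {d} Q.
Arguments downset {d} Q.
Arguments object {k d Q} t M.

Section Encodings.
Variables (k : fieldType) (d : Order.disp_t) (Q : porderType d).

Program Definition ppullback (d' : Order.disp_t) (P : porderType d') (pi : Q -> P)
    (pi_homo : {homo pi : x y / (x <= y)%O}) (H : pmodule k P) : pmodule k Q :=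
  @PModule k d Q (fun q => H (pi q)) (fun q q' h x => pmap H (pi_homo _ _ h) x) _ _ _.
Next Obligation. by move=> *; apply: pmap_linear. Qed.
Next Obligation. by move=> *; apply: pmap_id. Qed.
Next Obligation. by move=> *; apply: pmap_comp. Qed.

Record encoding (M : pmodule k Q) := Encoding {
  enc_disp : Order.disp_t;
  enc_poset : porderType enc_disp;
  enc_map : Q -> enc_poset;
  enc_homo : {homo enc_map : x y / (x <= y)%O};
  enc_mod : pmodule k enc_poset;
  enc_iso : piso M (ppullback enc_homo enc_mod) }.

Definition finite_encoding (M : pmodule k Q) (e : encoding M) : Prop :=
  finite_set [set: enc_poset e] /\ forall p, finite_dimensional (enc_mod e p).

Definition finitely_encoded (M : pmodule k Q) : Prop :=
  exists e : encoding M, finite_encoding e.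

(* [subordinate X e] also reads "e dominates X". *)
Definition subordinate (M : pmodule k Q) (t : object_kind) (X : object t M)
    (e : encoding M) : Prop :=
  forall (s : summand X) (q q' : Q),
    enc_map e q = enc_map e q' -> (summand_set s q <-> summand_set s q').
End Encodings.

Record posCone (R : realType) (V : vectType R) := PosCone {
  cone :> {pred V};
  cone0 : 0 \in cone;
  coneD : {in cone &, forall x y, x + y \in cone};
  cone_unit : forall x, x \in cone -> - x \in cone -> x = 0;
  cone_gen : forall S : {pred V}, zmod_closed S -> {subset cone <= S} ->
    forall v, v \in S }.

Fact povs_display : Order.disp_t. Proof. exact: Order.Disp tt tt. Qed.

Definition povs (R : realType) (V : vectType R) (C : posCone V) : Type := V.

Section Povs.
Variables (R : realType) (V : vectType R) (C : posCone V).
HB.instance Definition _ := Choice.on (povs C).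
Definition povs_le (q q' : povs C) : bool := (q' : V) - (q : V) \in cone C.
Lemma povs_le_refl : reflexive povs_le.
Proof. by move=> q; rewrite /povs_le subrr cone0. Qed.
Lemma povs_le_anti : antisymmetric povs_le.
Proof.
move=> q q' /andP[h h']; apply/esym/eqP; rewrite -subr_eq0; apply/eqP.
by apply: cone_unit h _; rewrite opprB.
Qed.
Lemma povs_le_trans : transitive povs_le.
Proof.
move=> y x z; rewrite /povs_le => h h'.
by rewrite -(subrKA (y : V)) coneD.
Qed.
HB.instance Definition _ := Order.Le_isPOrder.Build povs_display (povs C)
  povs_le_refl povs_le_anti povs_le_trans.
End Povs.

(* Finite unions of sets cut out by polynomial equations p = 0 and strict
   inequalities p > 0 in the coordinates of a basis; the class does not depend
   on the basis. *)
Definition semialgebraic_set (R : realType) (V : vectType R) (S : set V) : Prop :=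
  let n := \dim {:V} in
  let ev (v : V) (p : mpoly.mpoly n R) : R :=
    mpoly.meval (fun i => coord (vbasis {:V}) i v) p in
  exists s : seq (seq (mpoly.mpoly n R) * seq (mpoly.mpoly n R)),
    forall v : V, S v <->
      has (fun eqs_ineqs => all (fun p => ev v p == 0) eqs_ineqs.1
                         && all (fun p => 0 < ev v p) eqs_ineqs.2) s.

Section Semialgebraic.
Variables (k : fieldType) (R : realType) (V : vectType R) (C : posCone V).

Definition semialgebraic_encoding (M : pmodule k (povs C)) (e : encoding M) : Prop :=
  finite_encoding e /\
  forall p, @semialgebraic_set R V [set v : V | enc_map e (v : povs C) = p]%classic.

Definition semialgebraic_module (M : pmodule k (povs C)) : Prop :=
  exists e : encoding M, semialgebraic_encoding e.

Definition semialgebraic_object (M : pmodule k (povs C)) (t : object_kind)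
    (X : object t M) : Prop :=
  exists e : encoding M, semialgebraic_encoding e /\ subordinate X e.
End Semialgebraic.

(* Main.v *)
From HB Require Import structures.
From Stdlib Require Import Relations.
From mathcomp Require Import all_boot all_order all_algebra.
From mathcomp Require Import boolp classical_sets cardinality reals.
Require Import Defs.

Set Implicit Arguments.
Unset Strict Implicit.
Unset Printing Implicit Defensive.

Import Order.TTheory GRing.Theory Num.Theory.
Local Open Scope ring_scope.

Local Obligation Tactic := idtac.

(** Both halves of the theorem follow from two constructions: an encoding with
    finite poset and finite-dimensional values yields objects of all five kinds
    subordinate to it ([encoding_finite_object]), and an object with finitely
    many summands yields a finite encoding that dominates it
    ([finite_object_encoding]).  The semialgebraic half needs only the first
    construction, since it never changes the encoding.

    Everything is computed in one model.  Given intervals [A i] of the poset,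
    [isum] is the module whose value at [q] is the space of functions on the
    indices that vanish at [i] when [q] lies outside [A i].  Direct sums of
    upset modules and direct sums of downset modules are both of this form
    ([sum_chart]), and under this identification connectedness says that the
    map is given by one matrix of scalars.  The value of [isum] at [q] depends
    only on which intervals contain [q], so pulling back along an encoding map
    commutes with it by definition.

    From encodings to objects.  Over a finite poset [P], every module [K] with
    finite-dimensional values is covered by a sum of modules of principal
    upsets, one for each element of a basis of each [K p].  The cover is
    injective in the minimal degrees of the support of [K], so the support of
    the kernel is strictly higher, and iterating kernels stops after at most
    [#|P|] steps ([syzygy_eq0]).  This is a finite upset resolution.  Sums of
    modules of principal downsets and iterated cokernels give the downset
    resolution in the same way, and composing the cover with the hull gives a
    fringe presentation.  The homomorphisms that occur are automatically
    connected, because a homomorphism out of a principal upset module is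
    determined in its generating degree, and dually.  Pulling back along the
    encoding map preserves exactness, finiteness and connectedness.

    From objects to encodings.  Let [T] index the summands of a finite object.
    Sending [q] to the set of summands that contain it maps [Q] into the finite
    set of subsets of [T].  The order to put there is the one generated by the
    images of the relations of [Q] ([regions]), and not inclusion of subsets: a
    connected map such as the projection of [k[Q]] to a connected component of
    [Q] is in general not natural for inclusion.  The matrix of the object
    defines a map over the poset of regions, natural along each generating
    relation because the original map is natural along a relation of [Q] above
    it ([connected_descent]).  The cokernel, kernel or image of this map is
    finite-dimensional in each degree and pulls back to the given module. *)

(** * Finite-dimensional vector spaces *)

Section FiniteDimension.
Variable k : fieldType.
Implicit Types V W : lmodType k.

Record coordinates V := Coordinates {
  cdim : nat;
  cvec : 'I_cdim -> V;
  coor : V -> 'I_cdim -> k;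
  coor_linear : forall a u v i, coor (a *: u + v) i = a * coor u i + coor v i;
  coorK : forall v, \sum_i coor v i *: cvec i = v;
  cvecK : forall c i, coor (\sum_j c j *: cvec j) i = c i }.

Arguments cdim {V} _.
Arguments cvec {V} _ _.
Arguments coor {V} _ _ _.
Arguments coorK {V} _ _.
Arguments cvecK {V} _ _ _.
Arguments coor_linear {V} _ _ _ _ _.

Lemma finite_dimensionalP V : finite_dimensional V <-> inhabited (coordinates V).
Proof.
split=> [[n [[f f_lin [g fK gK]]]]|[b]].
  have g_lin : linear g.
    by move=> a u v; rewrite -[in LHS](gK u) -[in LHS](gK v) -f_lin fK.
  pose gL := GRing.isLinear.Build k _ _ _ g g_lin.
  pose G : {linear 'rV_n -> V} := HB.pack g gL.
  constructor; apply: (@Coordinates V n (fun i => g (delta_mx 0 i)) (fun v i => f v 0 i)).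
  - by move=> a u v i; rewrite f_lin !mxE.
  - move=> v; rewrite -[RHS]fK -[RHS]/(G _) [in RHS](row_sum_delta (f v)) linear_sum.
    by apply: eq_bigr => i _; rewrite linearZ.
  - move=> c i; rewrite (_ : \sum_j _ = G (\row_j c j)) ?gK ?mxE //.
    rewrite (row_sum_delta (\row_j c j)) linear_sum.
    by apply: eq_bigr => j _; rewrite mxE linearZ.
exists (cdim b); constructor; exists (fun v => \row_i coor b v i).
  by move=> a u v; apply/rowP=> i; rewrite !mxE coor_linear.
exists (fun r : 'rV_(cdim b) => \sum_i r 0 i *: cvec b i) => [v|r].
  by rewrite -[RHS](coorK b); apply: eq_bigr => i _; rewrite mxE.
by apply/rowP => i; rewrite mxE cvecK.
Qed.

Definition independent V m (e : 'I_m -> V) :=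
  forall c : 'I_m -> k, \sum_i c i *: e i = 0 -> forall i, c i = 0.

(** Bounded rank is inherited by subspaces and by quotients, because independent
    families can be pushed forward along injections and lifted along
    surjections; so boundedness is the form in which finite dimension passes to
    kernels and cokernels. *)
Definition bounded_rank V :=
  exists n, forall m (e : 'I_m -> V), independent e -> (m <= n)%N.

Lemma finite_dimensional_bounded V : finite_dimensional V -> bounded_rank V.
Proof.
case/finite_dimensionalP=> b; exists (cdim b) => m e e_free.
pose A : 'M[k]_(m, cdim b) := \matrix_(i, j) coor b (e i) j.
suff /eqP <- : row_free A by apply: rank_leq_col.
rewrite -kermx_eq0; apply/eqP/row_matrixP => i; rewrite row0.
have /rowP KA : row i (kermx A) *m A = 0 by rewrite -row_mul mulmx_ker row0.
apply/rowP=> j; rewrite [RHS]mxE; apply: (e_free (fun j => row i (kermx A) 0 j)).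
transitivity (\sum_l (row i (kermx A) *m A) 0 l *: cvec b l); last first.
  by rewrite big1 // => l _; rewrite KA mxE scale0r.
transitivity (\sum_l \sum_j0 (row i (kermx A) 0 j0 * A j0 l) *: cvec b l).
  rewrite exchange_big; apply: eq_bigr => j0 _ /=.
  rewrite -[in LHS](coorK b (e j0)) scaler_sumr; apply: eq_bigr => l _.
  by rewrite scalerA !mxE.
by apply: eq_bigr => l _; rewrite -scaler_suml [(row _ _ *m _) _ _]mxE.
Qed.

(** A maximal independent family spans, since adjoining any further vector
    creates a relation in which that vector has a nonzero coefficient. *)
Lemma bounded_finite_dimensional V : bounded_rank V -> finite_dimensional V.
Proof.
move=> [n V_n].
pose P m := `[< exists e : 'I_m -> V, independent e >].
have P0 : exists m, P m.
  exists 0%N; apply/asboolP; exists (fun=> 0) => c _ i; by case: i.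
have Pn m : P m -> (m <= n)%N by move=> /asboolP[e /V_n].
case: (ex_maxnP P0 Pn) => m /asboolP[e e_free] m_max.
have e_span v : exists c : 'I_m -> k, \sum_i c i *: e i = v.
  apply: contrapT => v_notin; suff: P m.+1 by move=> /m_max; rewrite ltnn.
  apply/asboolP; exists (fun i => if unlift ord0 i is Some j then e j else v) => c.
  rewrite big_ord_recl unlift_none; under eq_bigr do rewrite liftK.
  move=> rel_c; have [c0|c0] := eqVneq (c ord0) 0; last first.
    case: v_notin; exists (fun i => - (c ord0)^-1 * c (lift ord0 i)).
    apply: (scalerI c0); apply/esym/eqP; rewrite -subr_eq0; apply/eqP; rewrite -[RHS]rel_c.
    congr (_ + _); rewrite scaler_sumr -sumrN; apply: eq_bigr => i _.
    by rewrite scalerA mulNr mulrN mulVKf // scaleNr opprK.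
  move: rel_c; rewrite c0 scale0r add0r => /e_free cl i.
  by case: (unliftP ord0 i) => [j|] -> //; apply: cl.
pose co v := projT1 (cid (e_span v)).
have coE v : \sum_i co v i *: e i = v by rewrite /co; case: cid.
have co_uniq c v : \sum_i c i *: e i = v -> forall i, co v i = c i.
  move=> cv i; apply/eqP; rewrite -subr_eq0; apply/eqP.
  apply: (e_free (fun i => co v i - c i)).
  under eq_bigr do rewrite scalerBl.
  by rewrite sumrB coE cv subrr.
apply/finite_dimensionalP; constructor; apply: (@Coordinates V m e co) => //.
- move=> a u v i; apply: (co_uniq (fun i => a * co u i + co v i)).
  under eq_bigr do rewrite scalerDl -scalerA.
  by rewrite big_split -scaler_sumr !coE.
- by move=> c i; apply: co_uniq.
Qed.

Lemma finite_dimensional_inj V W (f : {linear V -> W}) :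
  injective f -> finite_dimensional W -> finite_dimensional V.
Proof.
move=> f_inj /finite_dimensional_bounded[n W_n].
apply: bounded_finite_dimensional; exists n => m e e_free.
apply: (W_n m (fun i => f (e i))) => c rel_c; apply: e_free.
apply: f_inj; rewrite linear0 -rel_c linear_sum.
by apply: eq_bigr => i _; rewrite linearZ.
Qed.

Lemma finite_dimensional_surj V W (f : {linear V -> W}) :
  (forall y, exists x, f x = y) -> finite_dimensional V -> finite_dimensional W.
Proof.
move=> f_surj /finite_dimensional_bounded[n V_n].
apply: bounded_finite_dimensional; exists n => m e e_free.
pose g y := projT1 (cid (f_surj y)).
have gK y : f (g y) = y by rewrite /g; case: cid.
apply: (V_n m (fun i => g (e i))) => c rel_c; apply: e_free.
rewrite -[RHS](linear0 f) -rel_c linear_sum.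
by apply: eq_bigr => i _; rewrite linearZ gK.
Qed.

Definition fd_coordinates V (V_fd : finite_dimensional V) : coordinates V :=
  inhabited_witness (proj1 (finite_dimensionalP V) V_fd).

Lemma coor0 V (b : coordinates V) i : coor b 0 i = 0.
Proof. by have := coor_linear b (-1) 0 0 i; rewrite scaler0 addr0 mulN1r addNr. Qed.

Lemma no_coordinates V (b : coordinates V) : (forall x : V, x = 0) -> 'I_(cdim b) -> False.
Proof.
move=> V0 i; have := cvecK b (fun=> 1) i; rewrite (V0 (\sum_j _)).
by rewrite coor0 => /esym/eqP; rewrite oner_eq0.
Qed.
End FiniteDimension.

Arguments cdim {k V} _.
Arguments cvec {k V} _ _.
Arguments coor {k V} _ _ _.
Arguments coorK {k V} _ _.
Arguments cvecK {k V} _ _ _.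
Arguments coor_linear {k V} _ _ _ _ _.

(** * Homomorphisms of modules over a poset *)

Section PosetModules.
Variables (k : fieldType) (d : Order.disp_t) (Q : porderType d).
Implicit Types L M N : pmodule k Q.

Definition pinjective M N (f : phom M N) := forall q x, f q x = 0 -> x = 0.
Definition psurjective M N (f : phom M N) := forall q y, exists x, f q x = y.

Lemma pinjectiveP M N (f : phom M N) q : pinjective f -> injective (f q).
Proof.
move=> f_inj x y fxy; apply/eqP; rewrite -subr_eq0; apply/eqP/(f_inj q).
by rewrite linearB /= fxy subrr.
Qed.

Lemma phom_inverse M N (f : phom M N) : pinjective f -> psurjective f ->
  exists g : phom N M, forall q, cancel (f q) (g q) /\ cancel (g q) (f q).
Proof.
move=> f_inj f_surj; pose g q y := projT1 (cid (f_surj q y)).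
have gK q y : f q (g q y) = y by rewrite /g; case: cid.
have f_I q := @pinjectiveP _ _ f q f_inj.
have g_lin q : linear (g q) by move=> a x y; apply: f_I; rewrite linearP /= !gK.
have g_nat q q' (h : (q <= q')%O) x : g q' (pmap N h x) = pmap M h (g q x).
  by apply: f_I; rewrite hfun_nat !gK.
by exists (PHom g_lin g_nat) => q; split=> x /=; [apply: f_I|]; rewrite gK.
Qed.

Lemma piso_bij M N (f : phom M N) : pinjective f -> psurjective f -> piso M N.
Proof.
move=> f_inj f_surj; have [g fK] := phom_inverse f_inj f_surj.
by exists f => q; exists (g q); case: (fK q).
Qed.

Lemma piso_sym M N : piso M N -> piso N M.
Proof.
move=> [f f_bij]; have [|q y|g fK] := @phom_inverse _ _ f.
- by move=> q x fx0; apply: (bij_inj (f_bij q)); rewrite linear0.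
- by have [g _ gK] := f_bij q; exists (g y).
- by exists g => q; have [? ?] := fK q; exists (f q).
Qed.

Lemma piso_trans L M N : piso L M -> piso M N -> piso L N.
Proof.
move=> [f f_bij] [g g_bij]; exists (phom_comp g f) => q.
exact: bij_comp (g_bij q) (f_bij q).
Qed.

Lemma piso_hom M N : piso M N ->
  exists f : phom M N, pinjective f /\ psurjective f.
Proof.
move=> [f f_bij]; exists f; split=> [q x fx0|q y].
  by apply: (bij_inj (f_bij q)); rewrite linear0.
by have [g _ gK] := f_bij q; exists (g y).
Qed.

Lemma pquot_iso N L (S : psub N) (a : phom N L) : psurjective a ->
  (forall q x, a q x = 0 <-> x \in S q) -> piso (pquot_mod S) L.
Proof.
move=> a_surj aS; pose b q (x : pquot_mod S q) : L q := a q (qrepr x).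
have bE q x : b q (qclass (S q) x) = a q x.
  apply/eqP; rewrite /b -subr_eq0 -linearB; apply/eqP/aS.
  by rewrite -qclassP qreprK.
have b_lin q : linear (@b q).
  by move=> c x y; rewrite -[x]qreprK -[y]qreprK -linearP !bE linearP.
have b_nat q q' (h : (q <= q')%O) x :
    b q' (pmap (pquot_mod S) h x) = pmap L h (b q x).
  by rewrite -[x]qreprK /= pquot_mapE !bE hfun_nat.
apply: (@piso_bij _ _ (PHom b_lin b_nat)) => q y /=.
  rewrite -[y]qreprK bE => /aS Sy; rewrite -[RHS](linear0 (qclass (S q))).
  by apply/eqP; rewrite qclassP subr0.
by have [x <-] := a_surj q y; exists (qclass (S q) x); rewrite bE.
Qed.

Lemma psub_iso N L (S : psub N) (b : phom L N) : pinjective b ->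
  (forall q y, y \in S q <-> exists x, b q x = y) ->
  exists c : phom (psub_mod S) L,
    [/\ pinjective c, psurjective c & forall q y, b q (c q y) = val y].
Proof.
move=> b_inj bS.
have bP q x : b q x \in S q by apply/bS; exists x.
pose e q (x : L q) : psub_mod S q := Subspace (bP q x).
have e_lin q : linear (e q) by move=> a x y; apply: val_inj; rewrite /= linearP.
have e_nat q q' (h : (q <= q')%O) x :
    e q' (pmap L h x) = pmap (psub_mod S) h (e q x).
  by apply: val_inj; rewrite /= hfun_nat.
have [|q y|c ecK] := @phom_inverse _ _ (PHom e_lin e_nat).
- by move=> q x /(congr1 val) /b_inj.
- by have /bS[x bx] := valP y; exists x; apply: val_inj.
exists c; split=> [q y cy0|q x|q y].
- by have [_ /(_ y) <-] := ecK q; rewrite cy0 linear0.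
- by exists (e q x); have [/(_ x)] := ecK q.
- by have [_ /(_ y) /(congr1 val)] := ecK q.
Qed.

(** An object presents its module as a cokernel, a kernel, an image or a
    homology module in degree zero.  This lemma and the next four replace each
    of these by an exact (co)augmentation, a form that can be moved along charts
    and encodings without touching quotients or submodules. *)
Lemma pcokernel_iso M N L (f : phom M N) (a : phom N L) : psurjective a ->
  (forall q y, a q y = 0 <-> exists x, f q x = y) -> piso (pcokernel f) L.
Proof.
move=> a_surj af; apply: (pquot_iso a_surj) => q y.
by rewrite af; split=> [?|/pim_predP//]; apply/pim_predP.
Qed.

Lemma pkernel_iso M N L (f : phom M N) (b : phom L M) : pinjective b ->
  (forall q y, f q y = 0 <-> exists x, b q x = y) -> piso (pkernel f) L.
Proof.
move=> b_inj bf; have [|c [c_inj c_surj _]] := @psub_iso _ _ (pker f) _ b_inj.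
  by move=> q y; rewrite -bf; split=> /eqP.
exact: piso_bij c_inj c_surj.
Qed.

Lemma pimage_iso M N L (f : phom M N) (a : phom M L) (b : phom L N) :
  psurjective a -> pinjective b -> (forall q x, f q x = b q (a q x)) ->
  piso (pimage f) L.
Proof.
move=> a_surj b_inj fE; have [|c [c_inj c_surj _]] := @psub_iso _ _ (pim f) _ b_inj.
  move=> q y; split=> [/pim_predP[x <-]|[x <-]]; first by exists (a q x); rewrite -fE.
  by have [z <-] := a_surj q x; apply/pim_predP; exists z; rewrite fE.
exact: piso_bij c_inj c_surj.
Qed.

Lemma phomology0_iso M N N' L (f : phom M N) (a : phom N L) : psurjective a ->
  (forall q y, a q y = 0 <-> exists x, f q x = y) ->
  piso (phomology f (phom_zero N N')) L.
Proof.
move=> a_surj af.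
apply: (@pquot_iso _ _ _ (phom_comp a (psub_incl (pker (phom_zero N N'))))).
  move=> q y; have [x <-] := a_surj q y.
  have xK : x \in pker (phom_zero N N') q by rewrite pker_predE.
  by exists (Subspace xK).
move=> q y; rewrite ppre_predE /= af.
by split=> [?|/pim_predP//]; apply/pim_predP.
Qed.

Lemma pcohomology0_iso M N N' L (f : phom M N) (b : phom L M) : pinjective b ->
  (forall q y, f q y = 0 <-> exists x, b q x = y) ->
  piso (phomology (phom_zero N' M) f) L.
Proof.
move=> b_inj bf; have [|c [c_inj c_surj cE]] := @psub_iso _ _ (pker f) _ b_inj.
  by move=> q y; rewrite -bf; split=> /eqP.
apply: (@pquot_iso _ _ _ c) => // q y; rewrite ppre_predE /=.
split=> [cy0|/pim_predP[x y0]]; last first.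
  by apply: (b_inj q); rewrite cE; apply: esym y0.
by apply/pim_predP; exists 0; rewrite /= -cE cy0 linear0.
Qed.

Lemma phomology_eq0 L M N (f : phom L M) (g : phom M N) :
  (forall q y, g q y = 0 -> exists x, f q x = y) -> pis_zero (phomology f g).
Proof.
move=> fg q x; rewrite -[x]qreprK; move: (qrepr x) => {x} y.
apply/eqP; rewrite -[0](linear0 (qclass _)) qclassP subr0 ppre_predE /=.
by apply/pim_predP/fg; have /eqP := valP y.
Qed.

End PosetModules.

(** * Direct sums of interval modules as spaces of functions *)

Section SupportedFunctions.
Variables (k : fieldType) (I : choiceType).

(** The support is prescribed by a predicate [S] rather than by intervals and a
    degree: the values of an interval sum at two degrees that lie in the same
    intervals are then the same space. *)
Definition supp_pred (S : I -> Prop) : {pred prodspace (fun _ : I => k^o : lmodType k)} :=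
  fun c => `[< forall i, ~ S i -> c i = 0 >].
Arguments supp_pred S _ : clear implicits.

Lemma supp_closed S : submod_closed (supp_pred S).
Proof.
split=> [|a x y /asboolP x0 /asboolP y0]; apply/asboolP => // i Si.
by rewrite -[LHS]/(a *: x i + y i) x0 // y0 // scaler0 addr0.
Qed.
HB.instance Definition _ S :=
  GRing.isSubmodClosed.Build k _ (supp_pred S) (supp_closed S).

Definition fspace (S : I -> Prop) : lmodType k := subspace (supp_pred S).

Definition coef S (x : fspace S) : I -> k :=
  (val x : prodspace (fun _ : I => k^o : lmodType k)).

Lemma coef_supp S (x : fspace S) i : ~ S i -> coef x i = 0.
Proof. by move=> Si; have /asboolP := valP x; apply. Qed.

Lemma coef_inj S (x y : fspace S) : (forall i, S i -> coef x i = coef y i) -> x = y.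
Proof.
move=> xy; apply: val_inj; apply: functional_extensionality_dep => i.
have [Si|Si] := pselect (S i); first exact: xy.
exact: etrans (coef_supp x Si) (esym (coef_supp y Si)).
Qed.

Lemma coefP S a (x y : fspace S) i : coef (a *: x + y) i = a * coef x i + coef y i.
Proof. by []. Qed.
Lemma coefZ S a (x : fspace S) i : coef (a *: x) i = a * coef x i.
Proof. by []. Qed.
Lemma coef0 S i : coef (0 : fspace S) i = 0. Proof. by []. Qed.

Lemma trunc_subproof S (c : I -> k) :
  (fun i => if `[< S i >] then c i else 0) \in supp_pred S.
Proof. by apply/asboolP => i Si; case: asboolP. Qed.

(** Truncation is the only operation needed for structure maps: passing to a
    higher degree forgets the coefficients of the intervals that are left, and
    leaves the others unchanged. *)
Definition trunc S (c : I -> k) : fspace S := Subspace (trunc_subproof S c).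

Lemma truncE S c i : S i -> coef (trunc S c) i = c i.
Proof. by move=> Si; rewrite /coef /=; case: asboolP. Qed.

Lemma coef_trunc S c i : coef (trunc S c) i = if `[< S i >] then c i else 0.
Proof. by []. Qed.

Definition delta S i : fspace S := trunc S (fun j => (j == i)%:R).

Lemma coef_delta (S : I -> Prop) i j : S i -> coef (delta S i) j = (j == i)%:R.
Proof.
move=> Si; rewrite coef_trunc; have [->|ji] := eqVneq j i; last by rewrite if_same.
by case: asboolP.
Qed.

Lemma coef_sum S (K : Type) (r : seq K) (h : K -> fspace S) j :
  coef (\sum_(i <- r) h i) j = \sum_(i <- r) coef (h i) j.
Proof.
elim: r => [|i r IHr]; first by rewrite !big_nil.
by rewrite !big_cons -[h i]scale1r coefP mul1r scale1r IHr.
Qed.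

Lemma delta_decomposition S (r : seq I) (x : fspace S) : uniq r -> (forall i, i \in r) ->
  x = \sum_(i <- r) coef x i *: delta S i.
Proof.
move=> r_uniq r_all; apply: coef_inj => i Si; rewrite coef_sum (bigD1_seq i) //=.
rewrite coefZ coef_delta // eqxx mulr1 big1 ?addr0 // => i' i'i.
by rewrite coefZ truncE // eq_sym (negPf i'i) mulr0.
Qed.

Lemma single_support (S S' : I -> Prop) i (x : fspace S) : S' i ->
  (forall j, j != i -> coef x j = 0) -> x = coef x i *: trunc S (coef (delta S' i)).
Proof.
move=> Si x_i; apply: coef_inj => j Sj; rewrite coefZ truncE // coef_delta //.
by have [->|/x_i ->] := eqVneq j i; rewrite ?mulr1 ?mulr0.
Qed.
End SupportedFunctions.

Section IntervalSums.
Variables (k : fieldType) (d : Order.disp_t) (Q : porderType d) (I : choiceType).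

Definition intervals (A : I -> Q -> Prop) := forall i (q q' q'' : Q),
  (q <= q')%O -> (q' <= q'')%O -> A i q -> A i q'' -> A i q'.

Variables (A : I -> Q -> Prop) (Aint : intervals A).

(** Convexity of the intervals is what makes the structure maps compose: a
    coefficient killed at an intermediate degree must not be alive later. *)
Program Definition isum : pmodule k Q :=
  @PModule k d Q (fun q => fspace k (fun i => A i q))
    (fun q q' h x => trunc (fun i => A i q') (coef x)) _ _ _.
Next Obligation.
by move=> q q' h a x y; apply: coef_inj => i Ai; rewrite coefP !truncE // coefP.
Qed.
Next Obligation. by move=> q h x; apply: coef_inj => i Ai; rewrite truncE. Qed.
Next Obligation.
move=> q q' q'' h h' h'' x; apply: coef_inj => i Ai''; rewrite [LHS]truncE // [RHS]truncE //.
rewrite coef_trunc; case: asboolP => // Ai'; apply: coef_supp => Ai.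
exact: Ai' (Aint h h' Ai Ai'').
Qed.

End IntervalSums.

Section Connected.
Variables (k : fieldType) (d : Order.disp_t) (Q : porderType d) (I J : choiceType).
Variables (A : I -> Q -> Prop) (B : J -> Q -> Prop).
Variables (Aint : intervals A) (Bint : intervals B).

(** The entry [(i, j)] is tested on the functions supported at [i]; these
    correspond to the image of the [i]-th summand. *)
Definition connected (f : phom (isum k Aint) (isum k Bint)) := forall i j,
  exists lam : k, forall q, A i q -> B j q -> forall x : isum k Aint q,
    (forall i', i' != i -> coef x i' = 0) -> coef (f q x) j = lam * coef x i.
End Connected.

(** * Charts of upset and downset modules *)

Section Charts.
Variables (k : fieldType) (d : Order.disp_t) (Q : porderType d).

(** Upset modules are submodules of [k[Q]] and downset modules are quotients of
    it.  A chart reads off the scalar of an element in either case, so that the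
    three notions of connectedness become one. *)
Record chart (A : Q -> Prop) (M : pmodule k Q) := Chart {
  chart_fun :> forall q, M q -> k;
  chart_linear : forall q a (x y : M q),
    @chart_fun q (a *: x + y) = a * @chart_fun q x + @chart_fun q y;
  chart_nat : forall q q' (h : (q <= q')%O) x, A q' ->
    @chart_fun q' (pmap M h x) = @chart_fun q x;
  chart_inj : forall q (x : M q), @chart_fun q x = 0 -> x = 0;
  chart_surj : forall q, A q -> exists x, @chart_fun q x = 1;
  chart_supp : forall q x, ~ A q -> @chart_fun q x = 0 }.

Arguments chart_fun {A M} c q x.

Lemma chart0 A M (c : chart A M) q : c q 0 = 0.
Proof. by have := chart_linear c (-1) (0 : M q) 0; rewrite scaler0 addr0 mulN1r addNr. Qed.

Lemma chart_eq A M (c : chart A M) q x y : c q x = c q y -> x = y.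
Proof.
move=> cxy; apply/eqP; rewrite -subr_eq0 addrC -scaleN1r; apply/eqP.
by apply: (chart_inj (c := c)); rewrite chart_linear cxy mulN1r addNr.
Qed.

Lemma chart_onto A M (c : chart A M) q a : A q -> exists x, c q x = a.
Proof.
move=> Aq; have [x x1] := chart_surj c Aq; exists (a *: x).
by rewrite -[a *: x]addr0 chart_linear chart0 addr0 x1 mulr1.
Qed.

Definition upset_chart_fun (U : upset Q) q (x : upset_mod k U q) : k := (val x : pconst k Q q).

Program Definition upset_chart (U : upset Q) : chart U (upset_mod k U) :=
  @Chart U (upset_mod k U) (@upset_chart_fun U) _ _ _ _ _.
Next Obligation. by []. Qed.
Next Obligation. by []. Qed.
Next Obligation. by move=> U q x x0; apply: val_inj. Qed.
Next Obligation.
move=> U q Uq; have U1 : (1 : pconst k Q q) \in upset_sub k U q by apply/upset_predP; left.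
by exists (Subspace U1).
Qed.
Next Obligation. by move=> U q x Uq; have /upset_predP[] := valP x. Qed.

Definition downset_chart_fun (D : downset Q) q (x : downset_mod k D q) : k :=
  if `[< D q >] then (qrepr x : pconst k Q q) else 0.

Lemma downset_chartE (D : downset Q) q (x : pconst k Q q) : D q ->
  downset_chart_fun (pquot_proj (upset_sub k (downsetC D)) q x) = x.
Proof.
move=> Dq; rewrite /downset_chart_fun; case: asboolP => // _.
set y := qrepr _.
have : y - x \in upset_sub k (downsetC D) q by rewrite -qclassP qreprK.
by case/upset_predP=> // /eqP; rewrite subr_eq0 => /eqP.
Qed.

Program Definition downset_chart (D : downset Q) : chart D (downset_mod k D) :=
  @Chart D (downset_mod k D) (@downset_chart_fun D) _ _ _ _ _.
Next Obligation.
move=> D q a x y; have [Dq|Dq] := pselect (D q); last first.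
  by rewrite /downset_chart_fun; case: asboolP => //; rewrite mulr0 addr0.
rewrite -[x]qreprK -[y]qreprK -[qclass _ (qrepr x)]/(pquot_proj _ q _).
by rewrite -[qclass _ (qrepr y)]/(pquot_proj _ q _) -linearP !downset_chartE.
Qed.
Next Obligation.
move=> D q q' h x Dq'; have Dq := downsetP h Dq'.
rewrite -[x]qreprK -[qclass _ (qrepr x)]/(pquot_proj (upset_sub k (downsetC D)) q _).
by rewrite -hfun_nat !downset_chartE.
Qed.
Next Obligation.
move=> D q x x0; rewrite -[x]qreprK -[RHS](linear0 (qclass _)).
apply/eqP; rewrite qclassP subr0; apply/upset_predP.
by move: x0; rewrite /downset_chart_fun; case: asboolP => Dq; [right|left].
Qed.
Next Obligation.
move=> D q Dq.
by exists (pquot_proj (upset_sub k (downsetC D)) q (1 : pconst k Q q)); apply: downset_chartE.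
Qed.
Next Obligation. by move=> D q x Dq; rewrite /downset_chart_fun; case: asboolP. Qed.

Definition chart_connected A B M N (c : chart A M) (c' : chart B N) (f : phom M N) :=
  exists lam : k, forall q, A q -> B q -> forall x, c' q (f q x) = lam * c q x.

Lemma connected_UDP U D (f : phom (upset_mod k U) (downset_mod k D)) :
  connected_UD f <-> chart_connected (upset_chart U) (downset_chart D) f.
Proof.
split=> -[lam f_lam]; exists lam => q Uq Dq x.
  by rewrite f_lam //; apply: downset_chartE.
apply: (@chart_eq _ _ (downset_chart D)); rewrite f_lam //.
exact/esym/downset_chartE.
Qed.

Lemma connected_DDP D E (f : phom (downset_mod k D) (downset_mod k E)) :
  connected_DD f <-> chart_connected (downset_chart D) (downset_chart E) f.
Proof.
split=> -[lam f_lam]; exists lam => q Dq Eq x.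
  rewrite -[x]qreprK -[qclass _ _]/(pquot_proj (upset_sub k (downsetC D)) q _) f_lam //.
  by rewrite /= !downset_chartE.
apply: (@chart_eq _ _ (downset_chart E)); rewrite f_lam //=.
by rewrite !downset_chartE.
Qed.
End Charts.

Section SumCharts.
Variables (k : fieldType) (d : Order.disp_t) (Q : porderType d) (I : choiceType).
Variables (A : I -> Q -> Prop) (Aint : intervals A) (M : I -> pmodule k Q).
Variables (c : forall i, chart (A i) (M i)).

(** The finiteness needed for surjectivity is that of the index set: the target
    contains all functions, the source only those of finite support. *)
Program Definition sum_chart : phom (psum M) (isum k Aint) :=
  @PHom k d Q (psum M) (isum k Aint)
    (fun q x => trunc (fun i => A i q) (fun i => c i q (psum_proj M i q x))) _ _.
Next Obligation.
move=> q a x y; apply: coef_inj => i Ai; rewrite coefP !truncE //.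
by rewrite linearP chart_linear.
Qed.
Next Obligation.
move=> q q' h x; apply: coef_inj => i Ai; rewrite [RHS]truncE // truncE //.
rewrite hfun_nat chart_nat // coef_trunc; case: asboolP => // Aq.
exact: chart_supp.
Qed.

Lemma coef_sum_chart q x i : coef (sum_chart q x) i = c i q (psum_proj M i q x).
Proof. by rewrite coef_trunc; case: asboolP => // Ai; rewrite chart_supp. Qed.

Lemma sum_chart_inj : pinjective sum_chart.
Proof.
move=> q x x0; apply: val_inj; apply: functional_extensionality_dep => i.
by apply: (@chart_inj _ _ _ _ _ (c i)); rewrite -coef_sum_chart x0.
Qed.

Lemma sum_chart_surj : finite_set [set: I]%classic -> psurjective sum_chart.
Proof.
move=> I_fin q y.
have cy i : exists x, c i q x = coef y i.
  have [Ai|Ai] := pselect (A i q); first exact: chart_onto.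
  by exists 0; rewrite chart0 coef_supp.
pose x i := projT1 (cid (cy i)).
have xE i : c i q (x i) = coef y i by rewrite /x; case: cid.
have x_fin : (x : pprod M q) \in @fsupp_pred k d Q I M q.
  by apply/fsupp_predP; apply: sub_finite_set I_fin.
by exists (Subspace x_fin); apply: coef_inj => i Ai; rewrite coef_sum_chart -xE.
Qed.

Lemma sum_chart_injE i q (x : M i q) j :
  coef (sum_chart q (psum_inj M i q x)) j = if j == i then c i q x else 0.
Proof.
rewrite coef_sum_chart /psum_proj /= /psum_proj_fun /= /psum_inj_val.
have [->|ji] := eqVneq j i; first by rewrite dfwith_in.
by rewrite dfwith_out 1?eq_sym // chart0.
Qed.
End SumCharts.

Section SumChartsConnected.
Variables (k : fieldType) (d : Order.disp_t) (Q : porderType d) (I J : choiceType).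
Variables (A : I -> Q -> Prop) (Aint : intervals A) (M : I -> pmodule k Q).
Variables (B : J -> Q -> Prop) (Bint : intervals B) (N : J -> pmodule k Q).
Variables (c : forall i, chart (A i) (M i)) (c' : forall j, chart (B j) (N j)).
Variables (F : phom (psum M) (psum N)) (f : phom (isum k Aint) (isum k Bint)).
Hypothesis Ff : forall q x, sum_chart Bint c' q (F q x) = f q (sum_chart Aint c q x).

(** Connectedness passes to the model, where both the source and the target are
    function spaces and no distinction between upsets and downsets remains. *)
Lemma sum_chart_connected :
  (forall i j, chart_connected (c i) (c' j) (pcomponent F i j)) <-> connected f.
Proof.
split=> fc i j; have [lam f_lam] := fc i j; exists lam => q Ai Bj x.
  move=> x_i; have [y yx] := chart_onto (c i) (coef x i) Ai.
  have -> : x = sum_chart Aint c q (psum_inj M i q y).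
    apply: coef_inj => i' Ai'; rewrite sum_chart_injE yx.
    by have [->//|/x_i] := eqVneq i' i.
  rewrite -Ff coef_sum_chart sum_chart_injE eqxx; exact: f_lam.
have := f_lam q Ai Bj (sum_chart Aint c q (psum_inj M i q x)).
rewrite -Ff coef_sum_chart !sum_chart_injE eqxx; apply=> i' /negPf i'i.
by rewrite sum_chart_injE i'i.
Qed.
End SumChartsConnected.

(** * Principal upsets and downsets *)

Section Principal.
Variables (d : Order.disp_t) (P : porderType d) (I : choiceType).

Definition principal_up (a : I -> P) i q : Prop := (a i <= q)%O.
Definition principal_down (a : I -> P) i q : Prop := (q <= a i)%O.

Lemma principal_up_intervals a : intervals (principal_up a).
Proof. by move=> i q q' q'' qq' _ aq _; apply: le_trans qq'. Qed.
Lemma principal_down_intervals a : intervals (principal_down a).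
Proof. by move=> i q q' q'' _ q'q'' _; apply: le_trans. Qed.

End Principal.

Arguments principal_up_intervals {d P I} a.
Arguments principal_down_intervals {d P I} a.

Section PrincipalConnected.
Variables (k : fieldType) (d : Order.disp_t) (P : porderType d) (I J : choiceType).

(** A function supported at [i] in degree [q] is a multiple of the image of the
    generator of the [i]-th summand, which lives in degree [a i]; the scalar can
    therefore be read off in that single degree. *)
Lemma connected_principal_up (a : I -> P) (B : J -> P -> Prop)
    (Bint : intervals B) (f : phom (isum k (principal_up_intervals a)) (isum k Bint)) :
  connected f.
Proof.
move=> i j; exists (coef (f (a i) (delta k _ i)) j) => q aq Bj x x_i.
have xE : x = coef x i *: pmap (isum k (principal_up_intervals a)) aq (delta k _ i).
  by apply: single_support x_i; apply: lexx.
by rewrite [in LHS]xE linearZ /= hfun_nat coefZ truncE // mulrC.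
Qed.

(** The [j]-th coefficient in degree [q] does not change on the way up to the
    top degree [b j] of the [j]-th downset, so again one degree decides. *)
Lemma connected_principal_down (b : J -> P) (A : I -> P -> Prop)
    (Aint : intervals A) (f : phom (isum k Aint) (isum k (principal_down_intervals b))) :
  connected f.
Proof.
move=> i j; exists (coef (f (b j) (delta k _ i)) j) => q Ai qb x x_i.
have xE : pmap (isum k Aint) qb x = coef x i *: delta k _ i.
  apply: coef_inj => i' Ai'; rewrite coefZ !truncE //.
  by have [->|/x_i ->] := eqVneq i' i; rewrite ?mulr1 ?mulr0.
have fE : coef (f (b j) (pmap (isum k Aint) qb x)) j = coef (f q x) j.
  by rewrite hfun_nat truncE //; apply: lexx.
by rewrite -fE xE linearZ /= coefZ mulrC.
Qed.
End PrincipalConnected.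

(** * Covers by free modules and hulls by cofree modules *)

Section Push.
Variables (k : fieldType) (d : Order.disp_t) (P : porderType d) (K : pmodule k P).

(** Extending the structure maps by zero lets the cover and the hull be given by
    one formula over all of [P], with no proofs of comparability in the terms. *)
Definition push p q : K p -> K q :=
  match @idP (p <= q)%O with ReflectT h => pmap K h | ReflectF _ => fun=> 0 end.

Lemma pushE p q (h : (p <= q)%O) x : push q x = pmap K h x.
Proof.
rewrite /push; case: {-}_ / idP => [h'|//]; by rewrite (bool_irrelevance h' h).
Qed.

Lemma pushN p q : ~~ (p <= q)%O -> forall x : K p, push q x = 0.
Proof. by move=> pq x; rewrite /push; case: {-}_ / idP => // h; case/negP: pq. Qed.

Lemma push_id p x : push p x = x :> K p.
Proof. by rewrite (pushE (lexx p)) pmap_id. Qed.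

Lemma push_comp p q r (h : (q <= r)%O) (x : K p) : (p <= q)%O ->
  pmap K h (push q x) = push r x.
Proof.
move=> pq; rewrite (pushE pq) (pushE (le_trans pq h)).
exact: esym (pmap_comp K pq h (le_trans pq h) x).
Qed.

Lemma push_pmap p q r (h : (p <= q)%O) (x : K p) : (q <= r)%O ->
  push r (pmap K h x) = push r x.
Proof.
move=> qr; rewrite (pushE qr) (pushE (le_trans h qr)).
exact: esym (pmap_comp K h qr (le_trans h qr) x).
Qed.

Lemma push_linear p q : linear (@push p q).
Proof.
move=> a x y; case: (boolP (p <= q)%O) => h; first by rewrite !(pushE h) linearP.
by rewrite !pushN // scaler0 addr0.
Qed.
End Push.

Section Cover.
Variables (k : fieldType) (d : Order.disp_t) (P : porderType d) (s : seq P).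
Hypotheses (s_uniq : uniq s) (s_all : forall p, p \in s).
Variables (K : pmodule k P) (b : forall p, coordinates (K p)).

(** One generator (for the cover) or cogenerator (for the hull) for each vector
    of a basis of each value of [K]. *)
Definition basis_index : choiceType := {p : P & 'I_(cdim (b p))}.
Definition basis_degree (j : basis_index) : P := tag j.

Lemma basis_index_finite : finite_set [set: basis_index]%classic.
Proof.
apply/finite_seqP.
exists (flatten
  [seq [seq Tagged (fun p => 'I_(cdim (b p))) i | i <- enum 'I_(cdim (b p))] | p <- s]).
apply/seteqP; split=> // j _ /=; case: j => p i; apply/flatten_mapP; exists p => //.
by apply: map_f; rewrite mem_enum.
Qed.

Let F := isum k (principal_up_intervals basis_degree).
Let tg p (i : 'I_(cdim (b p))) : basis_index := Tagged (fun p => 'I_(cdim (b p))) i.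

Program Definition cover : phom F K :=
  @PHom k d P F K (fun q x =>
    \sum_(p <- s) \sum_i coef x (tg i) *: push q (cvec (b p) i)) _ _.
Next Obligation.
move=> q a x y; rewrite scaler_sumr -big_split; apply: eq_bigr => p _ /=.
rewrite scaler_sumr -big_split; apply: eq_bigr => i _ /=.
by rewrite coefP scalerDl scalerA.
Qed.
Next Obligation.
move=> q q' h x; rewrite linear_sum; apply: eq_bigr => p _ /=.
rewrite linear_sum; apply: eq_bigr => i _ /=; rewrite linearZ /=.
have [pq|pq] := boolP (p <= q)%O.
  by rewrite push_comp // truncE //; apply: le_trans pq h.
have x0 : coef x (tg i) = 0 by apply: coef_supp; apply/negP.
by rewrite coef_trunc x0 if_same !scale0r.
Qed.

Lemma cover_top q (x : F q) :
  (forall p (i : 'I_(cdim (b p))), p != q -> coef x (tg i) = 0) ->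
  cover q x = \sum_i coef x (tg i) *: cvec (b q) i.
Proof.
move=> x0; rewrite /= (bigD1_seq q) //= [X in _ + X]big1 ?addr0.
  by apply: eq_bigr => i _; rewrite push_id.
by move=> p pq; rewrite big1 // => i _; rewrite x0 // scale0r.
Qed.

Lemma cover_surj : psurjective cover.
Proof.
(* In the branch taken, [tag j] is [q]; pushing [y] along this equality avoids
   a transport between the values of [K]. *)
move=> q y; exists (trunc _ (fun j : basis_index =>
  if tag j == q then coor (b (tag j)) (push (tag j) y) (tagged j) else 0)).
rewrite cover_top => [|p i pq]; last by rewrite coef_trunc (negPf pq) if_same.
rewrite -[RHS](coorK (b q)); apply: eq_bigr => i _.
by rewrite truncE /= ?eqxx ?push_id //; apply: lexx.
Qed.

(** In a degree below which [K] vanishes there are no generators of lower degree,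
    and those of degree [q] are mapped to a basis of [K q].  This is why the
    support moves strictly up when a module is replaced by its syzygy. *)
Lemma cover_min_inj q : (forall p, (p < q)%O -> forall y : K p, y = 0) ->
  forall x : F q, cover q x = 0 -> x = 0.
Proof.
move=> K0 x; have x0 p (i : 'I_(cdim (b p))) : p != q -> coef x (tg i) = 0.
  move=> pq; have [le_pq|] := boolP (p <= q)%O.
    case: (no_coordinates (b := b p)) => //; apply: K0.
    by rewrite lt_neqAle pq.
  by move=> le_pq; apply: coef_supp; apply/negP.
rewrite cover_top // => sum0; apply: coef_inj => -[p i] _.
have [pq|/x0->//] := eqVneq p q; subst p.
by rewrite -[LHS](cvecK (b q) (fun i => coef x (tg i))) sum0 coor0.
Qed.

Let E := isum k (principal_down_intervals basis_degree).

Program Definition hull : phom K E :=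
  @PHom k d P K E (fun q y => trunc _ (fun j : basis_index =>
    coor (b (tag j)) (push (tag j) y) (tagged j))) _ _.
Next Obligation.
move=> q a x y; apply: coef_inj => j qj; rewrite coefP !truncE //.
by rewrite push_linear coor_linear.
Qed.
Next Obligation.
move=> q q' h y; apply: coef_inj => j qj; rewrite truncE // truncE // truncE.
  by rewrite push_pmap.
exact: le_trans h qj.
Qed.

Lemma hull_inj : pinjective hull.
Proof.
move=> q y hy; rewrite -[LHS](coorK (b q)) big1 // => i _.
have := congr1 (fun x => coef x (tg i)) hy; rewrite coef0 truncE ?push_id; last exact: lexx.
by move=> /= ->; rewrite scale0r.
Qed.

(** Dual to the previous vanishing argument: in a degree above which [K] vanishes
    the only cogenerators are the coordinates of [K q] itself. *)
Lemma hull_max_surj q : (forall p, (q < p)%O -> forall y : K p, y = 0) ->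
  forall x : E q, exists y, hull q y = x.
Proof.
move=> K0 x; exists (\sum_i coef x (tg i) *: cvec (b q) i).
apply: coef_inj => -[p i] qp; rewrite truncE //=.
have [pq|pq] := eqVneq p q; first by subst p; rewrite push_id cvecK.
case: (no_coordinates (b := b p)) => //; apply: K0.
by rewrite lt_neqAle eq_sym pq.
Qed.
End Cover.

(** * Iterated syzygies and cosyzygies *)

Lemma fspace_fd (k : fieldType) (I : choiceType) (S : I -> Prop) :
  finite_set [set: I]%classic -> finite_dimensional (fspace k S).
Proof.
move=> /finite_seqP[t tI].
pose f (x : fspace k S) : 'rV[k]_(size t) := \row_l coef x (tnth (in_tuple t) l).
have f_lin : linear f by move=> a x y; apply/rowP=> l; rewrite !mxE.
pose fL := GRing.isLinear.Build k _ _ _ f f_lin.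
pose G : {linear fspace k S -> 'rV[k]_(size t)} := HB.pack f fL.
apply: (finite_dimensional_inj (f := G)); last first.
  by exists (size t); constructor; exists id => //; exists id.
move=> x y xy; apply: coef_inj => i _.
have it : i \in t by have : [set: I]%classic i by []; rewrite tI.
have lt_it : (index i t < size t)%N by rewrite index_mem.
have := congr1 (fun r : 'rV_(size t) => r 0 (Ordinal lt_it)) xy.
by rewrite !mxE (tnth_nth i) /= nth_index.
Qed.

Lemma psub_fd (k : fieldType) d (Q : porderType d) (M : pmodule k Q) (S : psub M) q :
  finite_dimensional (M q) -> finite_dimensional (psub_mod S q).
Proof.
by apply: (finite_dimensional_inj (f := psub_incl S q)); apply: val_inj.
Qed.

Lemma pquot_fd (k : fieldType) d (Q : porderType d) (M : pmodule k Q) (S : psub M) q :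
  finite_dimensional (M q) -> finite_dimensional (pquot_mod S q).
Proof.
apply: (finite_dimensional_surj (f := pquot_proj S q)) => y.
by exists (qrepr y); apply: qreprK.
Qed.

Section Syzygies.
Variables (k : fieldType) (d : Order.disp_t) (P : porderType d) (s : seq P).
Hypotheses (s_uniq : uniq s) (s_all : forall p, p \in s).

(** Bundled so that taking syzygies, which relies on a choice of bases, can be
    iterated. *)
Record fdmodule := Fdmodule {
  fdm :> pmodule k P;
  fdm_fd : forall p, finite_dimensional (fdm p) }.

Definition fdm_basis (K : fdmodule) p : coordinates (K p) := fd_coordinates (fdm_fd K p).

Definition generator (K : fdmodule) : choiceType := basis_index (fdm_basis K).
Definition generator_degree (K : fdmodule) : generator K -> P :=
  @basis_degree _ _ _ _ (fdm_basis K).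

Definition free_module (K : fdmodule) := isum k (principal_up_intervals (@generator_degree K)).
Definition free_cover (K : fdmodule) : phom (free_module K) K := cover s (fdm_basis K).
Definition cofree_module (K : fdmodule) := isum k (principal_down_intervals (@generator_degree K)).
Definition cofree_hull (K : fdmodule) : phom K (cofree_module K) := hull (fdm_basis K).

Lemma generator_finite K : finite_set [set: generator K]%classic.
Proof. exact: (basis_index_finite s_all). Qed.

Lemma syzygy_fd K p : finite_dimensional (pkernel (free_cover K) p).
Proof.
exact/psub_fd/fspace_fd/generator_finite.
Qed.

Lemma cosyzygy_fd K p : finite_dimensional (pcokernel (cofree_hull K) p).
Proof.
exact/pquot_fd/fspace_fd/generator_finite.
Qed.

Definition next_syzygy K := Fdmodule (syzygy_fd K).
Definition next_cosyzygy K := Fdmodule (cosyzygy_fd K).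

Variable H : fdmodule.

Definition syzygy n := iter n next_syzygy H.
Definition cosyzygy n := iter n next_cosyzygy H.

Definition free_diff n : phom (free_module (syzygy n.+1)) (free_module (syzygy n)) :=
  phom_comp (psub_incl (pker (free_cover (syzygy n)))) (free_cover (syzygy n.+1)).
Definition cofree_diff n : phom (cofree_module (cosyzygy n)) (cofree_module (cosyzygy n.+1)) :=
  phom_comp (cofree_hull (cosyzygy n.+1)) (pquot_proj (pim (cofree_hull (cosyzygy n)))).

Lemma free_cover_exact n q y :
  free_cover (syzygy n) q y = 0 <-> exists x, free_diff n q x = y.
Proof.
split=> [/eqP y0|[x <-]]; last exact/eqP/(valP (free_cover (syzygy n.+1) q x)).
have [x xy] := cover_surj s_uniq s_all (fdm_basis (syzygy n.+1))
  (Subspace (y0 : y \in pker (free_cover (syzygy n)) q)).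
by exists x; apply: (congr1 val xy).
Qed.

Lemma free_diff_exact n q y :
  free_diff n q y = 0 <-> exists x, free_diff n.+1 q x = y.
Proof.
rewrite -free_cover_exact; split=> [y0|y0]; first exact: val_inj.
by rewrite -[LHS]/(val (free_cover (syzygy n.+1) q y)) y0.
Qed.

Lemma cofree_diff_exact0 n q y :
  cofree_diff n q y = 0 <-> exists x, cofree_hull (cosyzygy n) q x = y.
Proof.
have im0 : qclass (pim (cofree_hull (cosyzygy n)) q) y = 0 <->
    exists x, cofree_hull (cosyzygy n) q x = y.
  rewrite -[X in _ = X <-> _](linear0 (qclass (pim (cofree_hull (cosyzygy n)) q))).
  split=> [/eqP|yx]; first by rewrite qclassP subr0 => /pim_predP.
  by apply/eqP; rewrite qclassP subr0; apply/pim_predP.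
rewrite -im0; split=> [|y0]; first exact: hull_inj.
by rewrite -[LHS]/(cofree_hull (cosyzygy n.+1) q (qclass _ y)) y0 linear0.
Qed.

Lemma cofree_diff_exact n q y :
  cofree_diff n.+1 q y = 0 <-> exists x, cofree_diff n q x = y.
Proof.
rewrite cofree_diff_exact0; split=> -[x <-]; last by eexists.
by exists (qrepr x); rewrite /cofree_diff /= qreprK.
Qed.

(** The number of elements of [P] below [p] is a height function: it increases
    strictly along the order and is bounded by [size s]. *)
Definition lower_count p := count (fun r => (r <= p)%O) s.
Definition upper_count p := count (fun r => (p <= r)%O) s.

Lemma count_lt (a b : pred P) p : subpred a b -> ~~ a p -> b p ->
  (count a s < count b s)%N.
Proof.
move=> ab Nap bp; rewrite -(size_filter b) -(count_predC a (filter b s)) !count_filter.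
rewrite -[X in (X < _)%N]addn0 -(eq_count (a1 := predI a b)) => [|x /=].
  by rewrite ltn_add2l -has_count; apply/hasP; exists p; rewrite //= Nap.
by rewrite andb_idr //; apply: ab.
Qed.

Lemma lower_count_lt p r : (r < p)%O -> (lower_count r < lower_count p)%N.
Proof.
move=> rp; apply: (@count_lt _ _ p) => //; last by rewrite lt_geF.
by move=> x xr; apply: le_trans xr (ltW rp).
Qed.

Lemma upper_count_lt p r : (p < r)%O -> (upper_count r < upper_count p)%N.
Proof.
move=> pr; apply: (@count_lt _ _ p) => //; last by rewrite lt_geF.
by move=> x; apply: le_trans (ltW pr).
Qed.

(** Each passage to a syzygy clears one more level of the height function, since
    in the lowest degrees that remain the cover is injective. *)
Lemma syzygy_eq0 n p : (lower_count p <= n)%N -> forall x : syzygy n p, x = 0.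
Proof.
elim: n p => [|n IHn] p.
  rewrite leqn0 eqn0Ngt -has_count => /hasPn/(_ _ (s_all p)).
  by rewrite lexx.
move=> pn x; apply: val_inj.
apply: (cover_min_inj s_uniq s_all (b := fdm_basis (syzygy n)) (q := p)) (eqP (valP x)).
by move=> r rp; apply: IHn; rewrite -ltnS (leq_trans _ pn) ?lower_count_lt.
Qed.

Lemma cosyzygy_eq0 n p : (upper_count p <= n)%N -> forall x : cosyzygy n p, x = 0.
Proof.
elim: n p => [|n IHn] p.
  rewrite leqn0 eqn0Ngt -has_count => /hasPn/(_ _ (s_all p)).
  by rewrite lexx.
move=> pn x; rewrite -[x]qreprK -[RHS](linear0 (qclass _)).
apply/eqP; rewrite qclassP subr0; apply/pim_predP.
apply: (hull_max_surj (b := fdm_basis (cosyzygy n))).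
by move=> r rp; apply: IHn; rewrite -ltnS (leq_trans _ pn) ?upper_count_lt.
Qed.

Lemma generator_syzygy_empty n : (size s <= n)%N -> generator (syzygy n) -> False.
Proof.
move=> sn [p i]; apply: (no_coordinates _ i); apply: syzygy_eq0.
exact: leq_trans (count_size _ _) sn.
Qed.

Lemma generator_cosyzygy_empty n : (size s <= n)%N -> generator (cosyzygy n) -> False.
Proof.
move=> sn [p i]; apply: (no_coordinates _ i); apply: cosyzygy_eq0.
exact: leq_trans (count_size _ _) sn.
Qed.
End Syzygies.

(** * Pullback along an encoding map *)

Section Lifting.
Variables (k : fieldType) (d : Order.disp_t) (Q : porderType d).

Lemma phom_lift (L M N : pmodule k Q) (g : phom M N) (f : phom L N) :
  pinjective g -> psurjective g ->
  exists F : phom L M, forall q x, g q (F q x) = f q x.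
Proof.
move=> g_inj g_surj; have [h gK] := phom_inverse g_inj g_surj.
by exists (phom_comp h f) => q x /=; case: (gK q) => _ ->.
Qed.

(** Exactness in the middle moves along a ladder of which one only needs that the
    left vertical map is onto and the other two are injective. *)
Lemma exact_transport (L M N L' M' N' : pmodule k Q)
    (F : phom L M) (G : phom M N) (f : phom L' M') (g : phom M' N')
    (l : phom L L') (m : phom M M') (n : phom N N') :
  psurjective l -> pinjective m -> pinjective n ->
  (forall q x, m q (F q x) = f q (l q x)) ->
  (forall q x, n q (G q x) = g q (m q x)) ->
  (forall q y, g q y = 0 <-> exists x, f q x = y) ->
  forall q y, G q y = 0 <-> exists x, F q x = y.
Proof.
move=> l_surj m_inj n_inj mF nG fg q y; split=> [Gy0|[x <-]].
  have /fg[x' fx'] : g q (m q y) = 0 by rewrite -nG Gy0 linear0.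
  have [x lx] := l_surj q x'; exists x; apply: (pinjectiveP m_inj).
  by rewrite mF lx.
by apply: n_inj; rewrite nG mF; apply/fg; exists (l q x).
Qed.

Lemma exact_transport_inj (M N M' N' : pmodule k Q)
    (G : phom M N) (g : phom M' N') (m : phom M M') (n : phom N N') :
  pinjective m -> (forall q x, n q (G q x) = g q (m q x)) ->
  pinjective g -> pinjective G.
Proof.
by move=> m_inj nG g_inj q x Gx; apply/m_inj/g_inj; rewrite -nG Gx linear0.
Qed.

Lemma exact_transport_surj (M N M' N' : pmodule k Q)
    (G : phom M N) (g : phom M' N') (m : phom M M') (n : phom N N') :
  psurjective m -> pinjective n -> (forall q x, n q (G q x) = g q (m q x)) ->
  psurjective g -> psurjective G.
Proof.
move=> m_surj n_inj nG g_surj q y; have [x' gx'] := g_surj q (n q y).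
have [x mx] := m_surj q x'; exists x; apply: (pinjectiveP n_inj).
by rewrite nG mx.
Qed.
End Lifting.

Program Definition phom_id (k : fieldType) d (Q : porderType d) (M : pmodule k Q) :
  phom M M := @PHom k d Q M M (fun q x => x) _ _.
Next Obligation. by []. Qed.
Next Obligation. by []. Qed.

Section Pullback.
Variables (k : fieldType) (d d' : Order.disp_t) (Q : porderType d) (P : porderType d').
Variables (pi : Q -> P) (pi_homo : {homo pi : x y / (x <= y)%O}).
Variables (I J : choiceType) (A : I -> P -> Prop) (B : J -> P -> Prop).
Variables (Aint : intervals A) (Bint : intervals B).

Definition pull_sets (K : choiceType) (C : K -> P -> Prop) i (q : Q) := C i (pi q).

Lemma pull_intervals (K : choiceType) (C : K -> P -> Prop) :
  intervals C -> intervals (pull_sets C).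
Proof. by move=> Cint i q q' q'' /pi_homo h /pi_homo h'; apply: Cint h h'. Qed.

(** No transport is involved here: the value of an interval sum depends on the
    intervals only through their trace at a point, so the pullback of an interval
    sum and the interval sum of the pullbacks have the same values, and [f] can
    be used in degree [pi q] as it is. *)
Program Definition pull_isum (f : phom (isum k Aint) (isum k Bint)) :
    phom (isum k (pull_intervals Aint)) (isum k (pull_intervals Bint)) :=
  @PHom k d Q _ _ (fun q (x : isum k (pull_intervals Aint) q) => f (pi q) x) _ _.
Next Obligation. by move=> f q; apply: (hfun_linear f (pi q)). Qed.
Next Obligation. by move=> f q q' h x; apply: (hfun_nat f (pi_homo h)). Qed.

Lemma pull_isum_connected (f : phom (isum k Aint) (isum k Bint)) :
  connected f -> connected (pull_isum f).
Proof.
move=> fc i j; have [lam f_lam] := fc i j; exists lam => q; exact: (f_lam (pi q)).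
Qed.

Variable H : pmodule k P.

Program Definition pull_from_isum (f : phom (isum k Aint) H) :
    phom (isum k (pull_intervals Aint)) (ppullback pi_homo H) :=
  @PHom k d Q _ _ (fun q (x : isum k (pull_intervals Aint) q) => f (pi q) x) _ _.
Next Obligation. by move=> f q; apply: (hfun_linear f (pi q)). Qed.
Next Obligation. by move=> f q q' h x; apply: (hfun_nat f (pi_homo h)). Qed.

Program Definition pull_to_isum (f : phom H (isum k Bint)) :
    phom (ppullback pi_homo H) (isum k (pull_intervals Bint)) :=
  @PHom k d Q _ _ (fun q (x : ppullback pi_homo H q) => f (pi q) x) _ _.
Next Obligation. by move=> f q; apply: (hfun_linear f (pi q)). Qed.
Next Obligation. by move=> f q q' h x; apply: (hfun_nat f (pi_homo h)). Qed.
End Pullback.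

(** * Objects subordinate to a finite encoding *)

Lemma finite_sum_type (I J : Type) : finite_set [set: I]%classic ->
  finite_set [set: J]%classic -> finite_set [set: I + J]%classic.
Proof.
move=> I_fin J_fin.
rewrite (_ : [set: I + J]%classic = (inl @` [set: I] `|` inr @` [set: J])%classic).
  by rewrite finite_setU; split; apply: finite_image.
by apply/seteqP; split=> // -[i|j] _; [left|right]; eexists.
Qed.

Lemma finite_tagged_type (I : nat -> Type) N : (forall n, finite_set [set: I n]%classic) ->
  (forall n, (N <= n)%N -> I n -> False) -> finite_set [set: {n & I n}]%classic.
Proof.
move=> I_fin I_N.
apply: (@sub_finite_set _ _
  (\bigcup_(n in [set n | (n < N)%N]) (Tagged I (i := n) @` [set: I n]))%classic).
  by move=> [n i] _; exists n; [rewrite /= ltnNge; apply/negP => /I_N; apply|exists i].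
by apply: bigcup_finite => [|n _]; [apply: finite_II|apply: finite_image].
Qed.

Lemma finite_preimage_inj (S T : Type) (h : S -> T) : injective h ->
  finite_set [set: T]%classic -> finite_set [set: S]%classic.
Proof. by move=> h_inj T_fin; apply: (finite_preimage (f := h)) T_fin => x y _ _ /h_inj. Qed.

Section EncodedObjects.
Variables (k : fieldType) (d d' : Order.disp_t) (Q : porderType d) (P : porderType d').
Variables (pi : Q -> P) (pi_homo : {homo pi : x y / (x <= y)%O}).
Variables (s : seq P) (s_uniq : uniq s) (s_all : forall p, p \in s).
Variables (H : fdmodule k P) (M : pmodule k Q).
Variable (iota : phom M (ppullback pi_homo H)).
Hypotheses (iota_inj : pinjective iota) (iota_surj : psurjective iota).

Definition up_index n : choiceType := generator (syzygy s_all H n).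
Definition down_index n : choiceType := generator (cosyzygy s_all H n).

Program Definition up_set n (i : up_index n) : upset Q :=
  @Upset d Q (pull_sets pi (principal_up (@generator_degree k d' P _)) i) _.
Next Obligation. by move=> n i q q' /pi_homo h /le_trans; apply. Qed.

Program Definition down_set n (i : down_index n) : downset Q :=
  @Downset d Q (pull_sets pi (principal_down (@generator_degree k d' P _)) i) _.
Next Obligation. by move=> n i q q' /pi_homo h; apply: le_trans. Qed.

Let Fsum n := upset_sum k (@up_set n).
Let Esum n := downset_sum k (@down_set n).

Definition up_chart n : phom (Fsum n) _ :=
  sum_chart (pull_intervals pi_homo (principal_up_intervals (@generator_degree k d' P _)))
    (fun i : up_index n => upset_chart k (up_set i)).
Definition down_chart n : phom (Esum n) _ :=
  sum_chart (pull_intervals pi_homo (principal_down_intervals (@generator_degree k d' P _)))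
    (fun i : down_index n => downset_chart k (down_set i)).

Lemma up_chart_inj n : pinjective (@up_chart n).
Proof. exact: sum_chart_inj. Qed.
Lemma down_chart_inj n : pinjective (@down_chart n).
Proof. exact: sum_chart_inj. Qed.
Lemma up_chart_surj n : psurjective (@up_chart n).
Proof. exact/sum_chart_surj/(generator_finite s_all). Qed.
Lemma down_chart_surj n : psurjective (@down_chart n).
Proof. exact/sum_chart_surj/(generator_finite s_all). Qed.

(** The differential of the pulled-back resolution, conjugated by charts into the
    sums of upset modules; its connectedness comes from the principal upsets of
    [P], although the pulled-back upsets of [Q] need not be principal. *)
Lemma upset_differential n : exists F : phom (Fsum n.+1) (Fsum n),
  (forall i j, connected_UU (pcomponent F i j)) /\
  forall q x, up_chart n q (F q x) =
    pull_isum pi_homo (free_diff s_all H n) q (up_chart n.+1 q x).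
Proof.
have [F FE] := phom_lift
  (phom_comp (pull_isum pi_homo (free_diff s_all H n)) (up_chart n.+1))
  (@up_chart_inj n) (@up_chart_surj n).
exists F; split=> //.
apply/(sum_chart_connected FE)/pull_isum_connected.
exact: connected_principal_up.
Qed.

Lemma downset_differential n : exists F : phom (Esum n) (Esum n.+1),
  (forall i j, connected_DD (pcomponent F i j)) /\
  forall q x, down_chart n.+1 q (F q x) =
    pull_isum pi_homo (cofree_diff s_all H n) q (down_chart n q x).
Proof.
have [F FE] := phom_lift
  (phom_comp (pull_isum pi_homo (cofree_diff s_all H n)) (down_chart n))
  (@down_chart_inj n.+1) (@down_chart_surj n.+1).
exists F; split=> // i j; apply/connected_DDP; move: i j.
apply/(sum_chart_connected FE)/pull_isum_connected.
exact: connected_principal_down.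
Qed.

Lemma upset_augmentation : exists a : phom (Fsum 0) M, psurjective a /\
  forall q x, iota q (a q x) = pull_from_isum pi_homo (free_cover s H) q (up_chart 0 q x).
Proof.
have [a aE] := phom_lift
  (phom_comp (pull_from_isum pi_homo (free_cover s H)) (up_chart 0)) iota_inj iota_surj.
exists a; split=> //.
apply: (exact_transport_surj (up_chart_surj (n := 0)) iota_inj aE) => q y.
exact: (cover_surj s_uniq s_all).
Qed.

Lemma downset_coaugmentation : exists b : phom M (Esum 0), pinjective b /\
  forall q x, down_chart 0 q (b q x) = pull_to_isum pi_homo (cofree_hull H) q (iota q x).
Proof.
have [b bE] := phom_lift (phom_comp (pull_to_isum pi_homo (cofree_hull H)) iota)
  (@down_chart_inj 0) (@down_chart_surj 0).
exists b; split=> //; apply: (exact_transport_inj iota_inj bE) => q y.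
exact: hull_inj.
Qed.

Lemma upset_resolution_exists :
  exists (F : forall n, phom (Fsum n.+1) (Fsum n)) (a : phom (Fsum 0) M),
  [/\ forall n i j, connected_UU (pcomponent (F n) i j),
      psurjective a,
      forall q y, a q y = 0 <-> exists x, F 0 q x = y
    & forall n q y, F n q y = 0 <-> exists x, F n.+1 q x = y].
Proof.
pose F n := projT1 (cid (upset_differential n)).
have FP n : (forall i j, connected_UU (pcomponent (F n) i j)) /\
    forall q x, up_chart n q (F n q x) =
      pull_isum pi_homo (free_diff s_all H n) q (up_chart n.+1 q x).
  by rewrite /F; case: cid.
have [a [a_surj aE]] := upset_augmentation.
exists F, a; split=> // [n i j||n].
- exact: (FP n).1.
- apply: (exact_transport (up_chart_surj (n := 1)) (up_chart_inj (n := 0)) iota_inj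
    (FP 0).2 aE) => q y.
  exact: (@free_cover_exact k d' P s s_uniq s_all H 0 (pi q) y).
- apply: (exact_transport (up_chart_surj (n := n.+2)) (up_chart_inj (n := n.+1))
    (up_chart_inj (n := n)) (FP n.+1).2 (FP n).2) => q y.
  exact: (@free_diff_exact k d' P s s_uniq s_all H n (pi q) y).
Qed.

Lemma downset_resolution_exists :
  exists (F : forall n, phom (Esum n) (Esum n.+1)) (b : phom M (Esum 0)),
  [/\ forall n i j, connected_DD (pcomponent (F n) i j),
      pinjective b,
      forall q y, F 0 q y = 0 <-> exists x, b q x = y
    & forall n q y, F n.+1 q y = 0 <-> exists x, F n q x = y].
Proof.
pose F n := projT1 (cid (downset_differential n)).
have FP n : (forall i j, connected_DD (pcomponent (F n) i j)) /\
    forall q x, down_chart n.+1 q (F n q x) =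
      pull_isum pi_homo (cofree_diff s_all H n) q (down_chart n q x).
  by rewrite /F; case: cid.
have [b [b_inj bE]] := downset_coaugmentation.
exists F, b; split=> // [n i j||n].
- exact: (FP n).1.
- apply: (exact_transport iota_surj (down_chart_inj (n := 0)) (down_chart_inj (n := 1))
    bE (FP 0).2) => q y.
  exact: (@cofree_diff_exact0 k d' P s s_all H 0 (pi q) y).
- apply: (exact_transport (down_chart_surj (n := n)) (down_chart_inj (n := n.+1))
    (down_chart_inj (n := n.+2)) (FP n).2 (FP n.+1).2) => q y.
  exact: (@cofree_diff_exact k d' P s s_all H n (pi q) y).
Qed.

(** The cover followed by the hull has image [M]; it is connected because its
    source is a sum of modules of principal upsets. *)
Lemma fringe_exists :
  exists (F : phom (Fsum 0) (Esum 0)),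
  (forall i j, connected_UD (pcomponent F i j)) /\ piso (pimage F) M.
Proof.
have [a [a_surj aE]] := upset_augmentation.
have [b [b_inj bE]] := downset_coaugmentation.
exists (phom_comp b a); split; last exact: (pimage_iso (a := a) (b := b)).
move=> i j; apply/connected_UDP; move: i j.
pose f := phom_comp (cofree_hull H) (free_cover s H).
have FE q x : down_chart 0 q (b q (a q x)) = pull_isum pi_homo f q (up_chart 0 q x).
  by rewrite bE aE.
apply/(sum_chart_connected (F := phom_comp b a) FE)/pull_isum_connected.
exact: connected_principal_up.
Qed.

Definition subordinate_map (t : object_kind) (X : object t M) :=
  forall (i : summand X) (q q' : Q), pi q = pi q' -> (summand_set i q <-> summand_set i q').

Lemma up_set_subordinate n (i : up_index n) q q' : pi q = pi q' -> up_set i q <-> up_set i q'.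
Proof. by rewrite /= /pull_sets => ->. Qed.
Lemma down_set_subordinate n (i : down_index n) q q' :
  pi q = pi q' -> down_set i q <-> down_set i q'.
Proof. by rewrite /= /pull_sets => ->. Qed.

(** The presentations are the first steps of the resolutions. *)
Lemma finite_subordinate_objects (t : object_kind) :
  exists X : object t M, finite_object X /\ subordinate_map X.
Proof.
have fin_up n : finite_set [set: up_index n]%classic := generator_finite s_all _.
have fin_down n : finite_set [set: down_index n]%classic := generator_finite s_all _.
have [F [a [Fc a_surj aF FF]]] := upset_resolution_exists.
have [G [b [Gc b_inj Gb GG]]] := downset_resolution_exists.
case: t => /=.
- have [f [fc f_im]] := fringe_exists.
  exists (FringePresentation fc f_im).
  split; first exact: (finite_sum_type (fin_up 0) (fin_down 0)).
  by move=> [i|j]; [apply: up_set_subordinate|apply: down_set_subordinate].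
- exists (UpsetPresentation (Fc 0) (pcokernel_iso a_surj aF)).
  split; first exact: (finite_sum_type (fin_up 1) (fin_up 0)).
  by move=> [i|j]; apply: up_set_subordinate.
- exists (DownsetCopresentation (Gc 0) (pkernel_iso b_inj Gb)).
  split; first exact: (finite_sum_type (fin_down 0) (fin_down 1)).
  by move=> [i|j]; apply: down_set_subordinate.
- have FF0 n q x : F n q (F n.+1 q x) = 0 by apply/FF; exists x.
  have Fexact n : (0 < n)%N -> pis_zero (chain_homology F n).
    by case: n => // n _; apply: phomology_eq0 => q y /FF.
  exists (UpsetResolution Fc FF0 (phomology0_iso _ a_surj aF) Fexact).
  split; last by move=> [n i]; apply: up_set_subordinate.
  by apply: (finite_tagged_type (N := size s) fin_up) => n; apply: generator_syzygy_empty.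
- have GG0 n q x : G n.+1 q (G n q x) = 0 by apply/GG; exists x.
  have Gexact n : (0 < n)%N -> pis_zero (cochain_cohomology G n).
    by case: n => // n _; apply: phomology_eq0 => q y /GG.
  exists (DownsetResolution Gc GG0 (pcohomology0_iso _ b_inj Gb) Gexact).
  split; last by move=> [n i]; apply: down_set_subordinate.
  by apply: (finite_tagged_type (N := size s) fin_down) => n; apply: generator_cosyzygy_empty.
Qed.
End EncodedObjects.

(** * The poset of regions *)

Fact region_display : Order.disp_t. Proof. exact: Order.Disp tt tt. Qed.

Section Regions.
Variables (d : Order.disp_t) (Q : porderType d) (T : Type) (A : T -> Q -> Prop).

Definition up_closed (S : Q -> Prop) := forall q q', (q <= q')%O -> S q -> S q'.
Definition down_closed (S : Q -> Prop) := forall q q', (q <= q')%O -> S q' -> S q.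
Definition monotone_sets := forall t, up_closed (A t) \/ down_closed (A t).

Hypothesis A_mono : monotone_sets.

(** Subsets of the index set [T] of the given sets, represented by predicates so
    that membership in the set [A t] at the region of [q] is [A t q] by
    computation.  The monotonicity proof is a parameter of the type because the
    order relation below is antisymmetric only under it. *)
Definition regions & monotone_sets : Type := T -> Prop.
Local Notation P := (regions A_mono).
HB.instance Definition _ := gen_eqMixin P.
HB.instance Definition _ := gen_choiceMixin P.

Definition region_of (q : Q) : P := fun t => A t q.

Definition region_step (p p' : P) :=
  exists q q', [/\ (q <= q')%O, p = region_of q & p' = region_of q'].

(** The order generated by the image of the order of [Q].  Every relation between
    regions is a chain of relations that come from [Q]; this is what allows
    naturality to descend.  Predicates that are not the region of a point are
    isolated and do no harm. *)
Definition region_le (p p' : P) := `[< clos_refl_trans _ region_step p p' >].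

Lemma region_le_step p p' t : clos_refl_trans _ region_step p p' ->
  (up_closed (A t) -> p t -> p' t) /\ (down_closed (A t) -> p' t -> p t).
Proof.
elim=> {p p'} [p p' [q [q' [qq' -> ->]]]|//|p p' p'' _ [u v] _ [u' v']].
- by split=> A_t; apply: A_t.
- by split=> A_t; [move/(u A_t)/(u' A_t)|move/(v' A_t)/(v A_t)].
Qed.

Lemma region_le_refl : reflexive region_le.
Proof. by move=> p; apply/asboolP/rt_refl. Qed.

Lemma region_le_anti : antisymmetric region_le.
Proof.
move=> p p' /andP[/asboolP h /asboolP h']; apply: functional_extensionality_dep => t.
have [u v] := region_le_step t h; have [u' v'] := region_le_step t h'.
by apply: propext; case: (A_mono t) => A_t; split; auto.
Qed.

Lemma region_le_trans : transitive region_le.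
Proof. by move=> p p' p'' /asboolP h /asboolP h'; apply/asboolP/(rt_trans _ _ _ _ _ h h'). Qed.

HB.instance Definition _ := Order.Le_isPOrder.Build region_display P
  region_le_refl region_le_anti region_le_trans.

Lemma region_of_homo : {homo region_of : x y / (x <= y)%O}.
Proof. by move=> q q' qq'; apply/asboolP/rt_step; exists q, q'. Qed.

Definition region_sets (I : choiceType) (g : I -> T) i (p : P) : Prop := p (g i).

Lemma region_intervals (I : choiceType) (g : I -> T) : intervals (region_sets g).
Proof.
move=> i p p' p'' /asboolP h /asboolP h' p_i p''_i.
have [u v] := region_le_step (g i) h; have [u' v'] := region_le_step (g i) h'.
by case: (A_mono (g i)) => A_i; [apply: u p_i|apply: v' p''_i].
Qed.

Lemma regions_finite : finite_set [set: T]%classic -> finite_set [set: P]%classic.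
Proof.
move=> T_fin; have /finite_seqP[e eT] : finite_set [set: {classic T}]%classic by [].
pose n := size e; pose et := @tnth n {classic T} (in_tuple e).
pose f (v : {ffun 'I_n -> bool}) : P := fun t => exists2 i, et i = t & v i.
apply: (@sub_finite_set _ _ (f @` [set: {ffun 'I_n -> bool}])%classic).
  move=> p _; exists [ffun i => `[< p (et i) >]] => //.
  apply: functional_extensionality_dep => t; apply: propext; split.
    by move=> [i <-]; rewrite ffunE => /asboolP.
  move=> pt; have te : (t : {classic T}) \in e.
    by have : [set: {classic T}]%classic t by []; rewrite eT.
  have lt_te : (index (t : {classic T}) e < n)%N by rewrite index_mem.
  have etE : et (Ordinal lt_te) = t.
    by rewrite /et (tnth_nth (t : {classic T})) /= nth_index.
  by exists (Ordinal lt_te); rewrite // ffunE etE; apply/asboolP.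
exact/finite_image/finite_finset.
Qed.
End Regions.

(** * Descent of connected homomorphisms to regions *)

Arguments region_intervals {d Q T A} A_mono {I} g.

Section Descent.
Variables (k : fieldType) (d : Order.disp_t) (Q : porderType d) (T : Type).
Variables (A : T -> Q -> Prop) (A_mono : monotone_sets A).
Variables (I J : choiceType) (g : I -> T) (g' : J -> T).
Hypothesis I_fin : finite_set [set: I]%classic.

Let pi := @region_of d Q T A A_mono.
Let pi_homo := @region_of_homo d Q T A A_mono.
Let X := isum k (region_intervals A_mono g).
Let Y := isum k (region_intervals A_mono g').

(** The matrix of [f] acts in every region.  Naturality along a generating
    relation is that of [f] along a relation of [Q] above it, and it extends to
    chains because structure maps compose. *)
Lemma connected_descent (f : phom (isum k (pull_intervals pi_homo (region_intervals A_mono g)))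
    (isum k (pull_intervals pi_homo (region_intervals A_mono g')))) :
  connected f -> exists F : phom X Y, forall q x, f q x = F (pi q) x.
Proof.
move=> fc; pose lam i j := projT1 (cid (fc i j)).
have lamP i j q : A (g i) q -> A (g' j) q ->
    forall x : isum k (pull_intervals pi_homo (region_intervals A_mono g)) q,
    (forall i', i' != i -> coef x i' = 0) -> coef (f q x) j = lam i j * coef x i.
  by rewrite /lam; case: cid => l lP /=; apply: lP.
have /finite_seqP[e eI] := I_fin.
have e_all i : i \in undup e.
  by rewrite mem_undup; have : [set: I]%classic i by []; rewrite eI.
pose raw (c : I -> k) j := \sum_(i <- undup e) lam i j * c i.
have raw_linear S a (x y : fspace k S) j :
    raw (coef (a *: x + y)) j = a * raw (coef x) j + raw (coef y) j.
  rewrite /raw mulr_sumr -big_split; apply: eq_bigr => i _ /=.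
  by rewrite coefP mulrDr mulrCA.
pose F p (x : X p) : Y p := trunc (fun j => region_sets g' j p) (raw (coef x)).
have fE q x : f q x = F (pi q) x.
  apply: coef_inj => j Aj; rewrite truncE //.
  rewrite [in LHS](delta_decomposition x (undup_uniq e) e_all) linear_sum coef_sum.
  apply: eq_bigr => i _.
  have [Ai|Ai] := pselect (A (g i) q).
    rewrite (lamP i j) // => [|i' i'i]; rewrite coefZ coef_delta ?eqxx ?mulr1 //.
    by rewrite (negPf i'i) mulr0.
  by rewrite (coef_supp x Ai) scale0r linear0 mulr0.
have F_lin p : linear (F p).
  by move=> a x y; apply: coef_inj => j pj; rewrite coefP !truncE // raw_linear.
have F_nat p p' (h : (p <= p')%O) x : F p' (pmap X h x) = pmap Y h (F p x).
  have /asboolP h' := h; move: h x.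
  elim: h' => {p p'} [p p' [q [q' [qq' -> ->]]]|p|p p' p'' pp' IH p'p'' IH'] h x.
  - have := hfun_nat f qq' x; rewrite !fE => E.
    exact: E.
  - by rewrite !pmap_id.
  - have h1 : (p <= p')%O by apply/asboolP.
    have h2 : (p' <= p'')%O by apply/asboolP.
    by rewrite (pmap_comp _ h1 h2) IH' IH -(pmap_comp _ h1 h2).
by exists (PHom F_lin F_nat) => q x; rewrite fE.
Qed.
End Descent.

Section DescentOfObjects.
Variables (k : fieldType) (d : Order.disp_t) (Q : porderType d) (T : Type).
Variables (A : T -> Q -> Prop) (A_mono : monotone_sets A).
Hypothesis T_fin : finite_set [set: T]%classic.
Variables (I J : choiceType) (g : I -> T) (g' : J -> T).
Hypotheses (I_fin : finite_set [set: I]%classic) (J_fin : finite_set [set: J]%classic).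
Variables (M_ : I -> pmodule k Q) (N_ : J -> pmodule k Q).
Variables (c : forall i, chart (A (g i)) (M_ i)) (c' : forall j, chart (A (g' j)) (N_ j)).
Variable (F : phom (psum M_) (psum N_)).
Hypothesis F_conn : forall i j, chart_connected (c i) (c' j) (pcomponent F i j).

Let pi := @region_of d Q T A A_mono.
Let pi_homo := @region_of_homo d Q T A A_mono.
Let X := isum k (region_intervals A_mono g).
Let Y := isum k (region_intervals A_mono g').
Let src_chart := sum_chart (pull_intervals pi_homo (region_intervals A_mono g)) c.
Let tgt_chart := sum_chart (pull_intervals pi_homo (region_intervals A_mono g')) c'.

Let src_inj : pinjective src_chart. Proof. exact: sum_chart_inj. Qed.
Let src_surj : psurjective src_chart. Proof. exact: sum_chart_surj. Qed.
Let tgt_inj : pinjective tgt_chart. Proof. exact: sum_chart_inj. Qed.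
Let tgt_surj : psurjective tgt_chart. Proof. exact: sum_chart_surj. Qed.

(** With this square, the cokernel, kernel and image of [F] are computed over the
    poset of regions and moved back along the charts. *)
Lemma sum_descent : exists F' : phom X Y,
  forall q x, tgt_chart q (F q x) = pull_isum pi_homo F' q (src_chart q x).
Proof.
have [h hK] := phom_inverse src_inj src_surj.
pose f := phom_comp tgt_chart (phom_comp F h).
have fE q x : tgt_chart q (F q x) = f q (src_chart q x).
  by rewrite /f /=; have [-> _] := hK q.
have fc : connected f by apply/(sum_chart_connected (F := F) fE).
have [F' F'E] := connected_descent I_fin fc.
by exists F' => q x; rewrite fE F'E.
Qed.

Lemma isum_fd p : finite_dimensional (X p) /\ finite_dimensional (Y p).
Proof. by split; apply: fspace_fd. Qed.

Lemma cokernel_descent : exists (H : pmodule k (regions A_mono))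
    (a : phom (psum N_) (ppullback pi_homo H)),
  [/\ forall p, finite_dimensional (H p), psurjective a
    & forall q y, a q y = 0 <-> exists x, F q x = y].
Proof.
have [F' F'E] := sum_descent.
pose proj := pull_from_isum pi_homo (pquot_proj (pim F')).
exists (pcokernel F'), (phom_comp proj tgt_chart); split.
- by move=> p; apply/pquot_fd/(isum_fd p).2.
- move=> q y; have [x xy] := tgt_surj (qrepr y : Y (pi q)).
  by exists x; rewrite -[LHS]/(qclass (pim F' (pi q)) (tgt_chart q x)) xy; apply: qreprK.
- apply: (exact_transport (G := phom_comp proj tgt_chart) (g := proj)
    (n := phom_id _) src_surj tgt_inj _ F'E) => // q y.
  rewrite -[0](linear0 (qclass (pim F' (pi q)))).
  split=> [/eqP|yx]; first by rewrite [_ == _]qclassP subr0 => /pim_predP.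
  by apply/eqP; rewrite [_ == _]qclassP subr0; apply/pim_predP.
Qed.

Lemma kernel_descent : exists (H : pmodule k (regions A_mono))
    (b : phom (ppullback pi_homo H) (psum M_)),
  [/\ forall p, finite_dimensional (H p), pinjective b
    & forall q y, F q y = 0 <-> exists x, b q x = y].
Proof.
have [F' F'E] := sum_descent.
pose incl := pull_to_isum pi_homo (psub_incl (pker F')).
have [b bE] := phom_lift incl src_inj src_surj.
exists (pkernel F'), b; split.
- by move=> p; apply/psub_fd/(isum_fd p).1.
- by move=> q x bx; apply: val_inj; rewrite -[LHS]/(incl q x) -bE bx linear0.
- apply: (exact_transport (F := b) (f := incl) (l := phom_id _) _ src_inj tgt_inj _ F'E).
  + by move=> q y; exists y.
  + by move=> q x; rewrite bE.
  move=> q y; split=> [/eqP y0|[x <-]]; last exact/eqP/(valP x).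
  by exists (Subspace (y0 : y \in pker F' (pi q))).
Qed.

Lemma image_descent : exists H : pmodule k (regions A_mono),
  (forall p, finite_dimensional (H p)) /\ piso (pimage F) (ppullback pi_homo H).
Proof.
have [F' F'E] := sum_descent.
pose incl := pull_to_isum pi_homo (psub_incl (pim F')).
have [b bE] := phom_lift incl tgt_inj tgt_surj.
have imP p x : F' p x \in pim F' p by apply/pim_predP; exists x.
pose e p (x : X p) : pimage F' p := Subspace (imP p x).
have e_lin p : linear (e p) by move=> a x y; apply: val_inj; rewrite /= linearP.
have e_nat p p' (h : (p <= p')%O) x : e p' (pmap X h x) = pmap (pimage F') h (e p x).
  by apply: val_inj; rewrite /= hfun_nat.
pose a := phom_comp (pull_from_isum pi_homo (PHom e_lin e_nat)) src_chart.
exists (pimage F'); split; first by move=> p; apply/psub_fd/(isum_fd p).2.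
apply: (pimage_iso (a := a) (b := b)).
- move=> q y; have /pim_predP[x' x'y] := valP y.
  have [x xx'] := src_surj x'; exists x; apply: val_inj.
  by rewrite -[RHS]x'y -xx'.
- by move=> q x bx; apply: val_inj; rewrite -[LHS]/(incl q x) -bE bx linear0.
- by move=> q x; apply: (pinjectiveP tgt_inj); rewrite bE F'E.
Qed.
End DescentOfObjects.

(** * Encodings and objects *)

Section EncodingsOfObjects.
Variables (k : fieldType) (d : Order.disp_t) (Q : porderType d) (M : pmodule k Q).

Lemma summand_monotone t (X : object t M) :
  monotone_sets (fun i : summand X => summand_set i : Q -> Prop).
Proof.
have U_up (U : upset Q) : up_closed U by apply: upsetP.
have D_down (D : downset Q) : down_closed D by apply: downsetP.
by case: t X => X; [move=> [i|i]|move=> [i|i]|move=> [i|i]|move=> i|move=> i];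
  (try by left; apply: U_up); right; apply: D_down.
Qed.

Arguments summand_monotone {t} X.

(** The regions are taken with respect to all summands, including those of the
    higher terms of a resolution, which is what makes the encoding dominate the
    whole object. *)
Lemma region_encoding t (X : object t M) (H : pmodule k (regions (summand_monotone X))) :
  finite_object X -> (forall p, finite_dimensional (H p)) ->
  piso M (ppullback (@region_of_homo _ _ _ _ (summand_monotone X)) H) ->
  exists e : encoding M, finite_encoding e /\ subordinate X e.
Proof.
move=> X_fin H_fin M_H; exists (Encoding M_H); split.
  by split=> //; apply: regions_finite.
move=> i q q' qq'; have E : summand_set i q = summand_set i q'.
  exact: (congr1 (fun p : regions (summand_monotone X) => p i : Prop) qq').
by rewrite E.
Qed.

Lemma finite_object_encoding t (X : object t M) : finite_object X ->
  exists e : encoding M, finite_encoding e /\ subordinate X e.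
Proof.
case: t X => X X_fin.
- have I_fin : finite_set [set: fr_I X]%classic.
    by apply: (finite_preimage_inj (h := inl)) X_fin => ? ? [].
  have J_fin : finite_set [set: fr_J X]%classic.
    by apply: (finite_preimage_inj (h := inr)) X_fin => ? ? [].
  have [i j|H [H_fin im_H]] := @image_descent k d Q _ _ (summand_monotone X) _ _ inl inr I_fin J_fin
    _ _ (fun i => upset_chart k (fr_U i)) (fun j => downset_chart k (fr_D j)) (fr_map X).
    exact/connected_UDP/fr_connected.
  apply: (region_encoding X_fin H_fin).
  exact: piso_trans (piso_sym (fr_image X)) im_H.
- have I_fin : finite_set [set: up_I1 X]%classic.
    by apply: (finite_preimage_inj (h := inl)) X_fin => ? ? [].
  have J_fin : finite_set [set: up_I0 X]%classic.
    by apply: (finite_preimage_inj (h := inr)) X_fin => ? ? [].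
  have [|H [a [H_fin a_surj aF]]] := @cokernel_descent k d Q _ _ (summand_monotone X)
    _ _ inl inr I_fin J_fin
    _ _ (fun i => upset_chart k (up_U1 i)) (fun j => upset_chart k (up_U0 j)) (up_map X).
    exact: up_connected.
  apply: (region_encoding X_fin H_fin).
  exact: piso_trans (piso_sym (up_coker X)) (pcokernel_iso a_surj aF).
- have I_fin : finite_set [set: dc_I0 X]%classic.
    by apply: (finite_preimage_inj (h := inl)) X_fin => ? ? [].
  have J_fin : finite_set [set: dc_I1 X]%classic.
    by apply: (finite_preimage_inj (h := inr)) X_fin => ? ? [].
  have [i j|H [b [H_fin b_inj bF]]] := @kernel_descent k d Q _ _ (summand_monotone X)
    _ _ inl inr I_fin J_fin
    _ _ (fun i => downset_chart k (dc_D0 i)) (fun j => downset_chart k (dc_D1 j)) (dc_map X).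
    exact/connected_DDP/dc_connected.
  apply: (region_encoding X_fin H_fin).
  exact: piso_trans (piso_sym (dc_ker X)) (pkernel_iso b_inj bF).
- have I_fin n : finite_set [set: ur_I X n]%classic.
    apply: (finite_preimage_inj (h := @Tagged _ _ _)) X_fin => i j /eqP.
    by rewrite eq_Tagged => /eqP.
  have [|H [a [H_fin a_surj aF]]] := @cokernel_descent k d Q _ _ (summand_monotone X)
    _ _ (existT _ 1) (existT _ 0) (I_fin 1) (I_fin 0)
    _ _ (fun i => upset_chart k (ur_U i)) (fun j => upset_chart k (ur_U j)) (ur_d X 0).
    exact: ur_connected.
  apply: (region_encoding X_fin H_fin).
  exact: piso_trans (piso_sym (ur_H0 X)) (phomology0_iso _ a_surj aF).
- have I_fin n : finite_set [set: dr_I X n]%classic.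
    apply: (finite_preimage_inj (h := @Tagged _ _ _)) X_fin => i j /eqP.
    by rewrite eq_Tagged => /eqP.
  have [i j|H [b [H_fin b_inj bF]]] := @kernel_descent k d Q _ _ (summand_monotone X)
    _ _ (existT _ 0) (existT _ 1) (I_fin 0) (I_fin 1)
    _ _ (fun i => downset_chart k (dr_D i)) (fun j => downset_chart k (dr_D j)) (dr_d X 0).
    exact/connected_DDP/dr_connected.
  apply: (region_encoding X_fin H_fin).
  exact: piso_trans (piso_sym (dr_H0 X)) (pcohomology0_iso _ b_inj bF).
Qed.

Lemma encoding_finite_object t (e : encoding M) : finite_encoding e ->
  exists X : object t M, finite_object X /\ subordinate X e.
Proof.
move=> [P_fin H_fin]; have /finite_seqP[s sP] := P_fin.
have s_all p : p \in undup s.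
  by rewrite mem_undup; have : [set: enc_poset e]%classic p by []; rewrite sP.
have [iota [iota_inj iota_surj]] := piso_hom (enc_iso e).
exact: (finite_subordinate_objects (undup_uniq s) s_all (H := Fdmodule H_fin) iota_inj iota_surj).
Qed.
End EncodingsOfObjects.

Theorem theorem5p16 (k : fieldType) :
  (forall (d : Order.disp_t) (Q : porderType d) (M : pmodule k Q),
    [/\ forall t : object_kind,
          finitely_encoded M <->
          exists X : object t M, finite_object X,
        forall t : object_kind,
          finitely_encoded M <->
          exists (e : encoding M) (X : object t M),
            [/\ finite_encoding e, finite_object X & subordinate X e],
        forall (t : object_kind) (e : encoding M),
          finite_encoding e ->
          exists X : object t M, finite_object X /\ subordinate X e
      & forall (t : object_kind) (X : object t M),
          finite_object X ->
          exists e : encoding M, finite_encoding e /\ subordinate X e])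
  /\
  (forall (R : realType) (V : vectType R) (C : posCone V) (M : pmodule k (povs C)),
    [/\ forall t : object_kind,
          semialgebraic_module M <->
          exists X : object t M, semialgebraic_object X,
        forall t : object_kind,
          semialgebraic_module M <->
          exists (e : encoding M) (X : object t M),
            [/\ semialgebraic_encoding e, semialgebraic_object X & subordinate X e],
        forall (t : object_kind) (e : encoding M),
          semialgebraic_encoding e ->
          exists X : object t M, semialgebraic_object X /\ subordinate X e
      & forall (t : object_kind) (X : object t M),
          semialgebraic_object X ->
          exists e : encoding M, semialgebraic_encoding e /\ subordinate X e]).
Proof.
split=> [d Q M|R V C M].
  have obj t e : finite_encoding e ->
      exists X : object t M, finite_object X /\ subordinate X e.
    exact: encoding_finite_object.
  have enc t (X : object t M) : finite_object X ->
      exists e : encoding M, finite_encoding e /\ subordinate X e.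
    exact: finite_object_encoding.
  split=> // t; split=> [[e e_fin]|].
  - by have [X [X_fin _]] := obj t e e_fin; exists X.
  - by move=> [X /enc[e [e_fin _]]]; exists e.
  - by have [X [X_fin Xe]] := obj t e e_fin; exists e, X.
  - by move=> [e [X [e_fin _ _]]]; exists e.
have obj t e : semialgebraic_encoding e ->
    exists X : object t M, semialgebraic_object X /\ subordinate X e.
  move=> e_sa; have [X [_ Xe]] := encoding_finite_object t e_sa.1.
  by exists X; split=> //; exists e.
split=> // t; split=> [[e e_sa]|].
- by have [X [X_sa _]] := obj t e e_sa; exists X.
- by move=> [X [e [e_sa _]]]; exists e.
- by have [X [X_sa Xe]] := obj t e e_sa; exists e, X.
- by move=> [e [X [e_sa _ _]]]; exists e.
Qed.
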